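(* Let $n$ be a given positive integer and let $f\in H^2(\mathbb{D})$. If $f$ is not an $m$-double-Blaschke form for any $m<n$, then there exists an $n$-tuple $\mathbf{a}=(a_1,\dots,a_n)\in\mathbb{D}^n$ such that $$\Big\|f-\sum_{j=1}^n\langle f,{}^{\mathbf a}\tilde B_j\rangle\,{}^{\mathbf a}\tilde B_j\Big\|=\inf_{\mathbf b\in\mathbb{D}^n}\Big\|f-\sum_{j=1}^n\langle f,{}^{\mathbf b}\tilde B_j\rangle\,{}^{\mathbf b}\tilde B_j\Big\|.$$
   Context: $\mathbb{D}$ is the open unit disc and $H^2(\mathbb{D})$ is the Hardy space of functions $f(z)=\sum_{k\ge0}c_kz^k$ with $\|f\|^2=\sum_{k\ge 0}|c_k|^2<\infty$, with inner product $\langle f,g\rangle=\frac1{2\pi}\int_0^{2\pi}f(e^{it})\overline{g(e^{it})}\,dt$ of the boundary values. For $a\in\mathbb{D}$, $e_a(z)=\frac{\sqrt{1-|a|^2}}{1-\overline{a}z}$. For an $n$-tuple $\mathbf a=(a_1,\dots,a_n)\in\mathbb{D}^n$ (repetitions allowed), the double Takenaka–Malmquist system $\{{}^{\mathbf a}\tilde B_k\}_{k=1}^n$ generated by $\mathbf a$ is ${}^{\mathbf a}\tilde B_1=e_{a_1}$, ${}^{\mathbf a}\tilde B_k(z)=e_{a_k}(z)\prod_{l=1}^{k-1}\left(\frac{z-a_l}{1-\overline{a}_lz}\right)^2$ for $2\le k\le n$; it is orthonormal. A function $f\in H^2(\mathbb{D})$ is an $m$-double-Blaschke form if there exist $\mathbf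 a=(a_1,\dots,a_m)\in\mathbb{D}^m$ and $c_1,\dots,c_m\in\mathbb{C}$ with $c_m\ne0$ such that $f=\sum_{k=1}^mc_k\,{}^{\mathbf a}\tilde B_k$. *)

(* Defs.v *)
From HB Require Import structures.
From mathcomp Require Import all_boot all_order all_algebra complex.
From mathcomp Require Import all_classical all_reals all_analysis.

Set Implicit Arguments.
Unset Strict Implicit.
Unset Printing Implicit Defensive.

Import Order.TTheory GRing.Theory Num.Theory.
Import numFieldNormedType.Exports.

Local Open Scope classical_set_scope.
Local Open Scope ring_scope.
Local Open Scope complex_scope.

(* The norm of R[i] takes its values in R[i]; cmod is the modulus as an element
   of R.  The topology used on the complex numbers is that of R[i]^o, the
   normed module structure of R[i] over itself. *)
Definition cmod (R : realType) (z : R[i]) : R := complex.Re `|z|.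

Definition unit_disc (R : realType) : set R[i] := [set z | cmod z < 1].

(* Functions on the disc are total functions R[i] -> R[i]; no definition below
   depends on their values outside the open unit disc. *)
Definition taylor_expansion (R : realType) (f : R[i] -> R[i]) (c : nat -> R[i])
    : Prop :=
  forall z, unit_disc z ->
    (series (fun k => c k * z ^+ k) : nat -> R[i]^o) @ \oo --> (f z : R[i]^o).

Definition hardy (R : realType) (f : R[i] -> R[i]) : Prop :=
  exists2 c : nat -> R[i], taylor_expansion f c &
    cvgn (series (fun k => cmod (c k) ^+ 2)).

(* The (necessarily unique) sequence of Taylor coefficients at 0, and the zero
   sequence for a function without power series expansion in the disc. *)
Definition taylor_coef (R : realType) (f : R[i] -> R[i]) : nat -> R[i] :=
  xget (fun=> 0) [set c | taylor_expansion f c].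

Definition hardy_norm (R : realType) (f : R[i] -> R[i]) : R :=
  Num.sqrt (limn (series (fun k => cmod (taylor_coef f k) ^+ 2))).

(* The boundary value f(e^{it}) is the radial limit of f, which exists for
   almost every t when f is in the Hardy space. *)
Definition boundary_value (R : realType) (f : R[i] -> R[i]) (t : R) : R[i] :=
  lim ((f (r%:C * (cos t +i* sin t)) : R[i]^o) @[r --> (1 : R)^'-]).

Definition complex_integral (R : realType) (a b : R) (g : R -> R[i]) : R[i] :=
  \int[@lebesgue_measure R]_(t in `[a, b]) complex.Re (g t) +i*
  \int[@lebesgue_measure R]_(t in `[a, b]) complex.Im (g t).

Definition hardy_inner (R : realType) (f g : R[i] -> R[i]) : R[i] :=
  ((2 * pi)^-1)%:C * complex_integral 0 (2 * pi)
    (fun t => boundary_value f t * (boundary_value g t)^*).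

Definition szego_kernel (R : realType) (a z : R[i]) : R[i] :=
  (Num.sqrt (1 - cmod a ^+ 2))%:C / (1 - a^* * z).

(* Tuples are indexed from 0: for k : 'I_n this is the function of index k + 1
   of the double Takenaka-Malmquist system generated by a. *)
Definition double_TM (R : realType) (n : nat) (a : 'I_n -> R[i]) (k : 'I_n)
    (z : R[i]) : R[i] :=
  szego_kernel (a k) z *
  \prod_(l < n | (l < k)%N) ((z - a l) / (1 - (a l)^* * z)) ^+ 2.

Definition disc_tuple (R : realType) (n : nat) (a : 'I_n -> R[i]) : Prop :=
  forall k, unit_disc (a k).

Definition double_blaschke_form (R : realType) (m : nat) (f : R[i] -> R[i])
    : Prop :=
  (0 < m)%N /\
  exists a c : 'I_m -> R[i],
    [/\ disc_tuple a,
        forall k : 'I_m, k.+1 = m -> c k != 0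
      & forall z, unit_disc z -> f z = \sum_(k < m) c k * double_TM a k z].

Definition double_TM_residual (R : realType) (n : nat) (f : R[i] -> R[i])
    (a : 'I_n -> R[i]) (z : R[i]) : R[i] :=
  f z - \sum_(j < n) hardy_inner f (double_TM a j) * double_TM a j z.

(* Main.v *)
Require Import Defs.
From HB Require Import structures.
From mathcomp Require Import all_boot all_order all_algebra complex.
From mathcomp Require Import all_classical all_reals all_analysis.
From mathcomp Require Import measurable_realfun ring lra.
Import Order.TTheory GRing.Theory Num.Theory.
Import numFieldNormedType.Exports.
Local Open Scope classical_set_scope.
Local Open Scope ring_scope.
Local Open Scope complex_scope.

(** Let B_1, ..., B_n be the system generated by a tuple a.  It is orthonormal,
    so the squared residual of f is |f|^2 - sum_k |<f, B_k>|^2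
    ([hardy_norm_residual]), and a best tuple is one that maximises the
    captured energy sum_k |<f, B_k>|^2 over D^n.

    Since D^n is not compact, the maximum is first taken over the closed
    polydisc.  The formulas for B_k still make sense there: for |a| = 1 the
    kernel e_a is zero and the Blaschke factor (z - a) / (1 - conj(a) z) is
    the unimodular constant - a.  The Taylor coefficients of B_k depend
    continuously on a up to the circle and have energy at most 1, so the
    captured energy is continuous ([captured_energy_continuous]) and attains
    its maximum.  At a maximising tuple a parameter on the circle contributes
    nothing itself and changes the other terms by a unimodular factor;
    deleting all such parameters leaves a shorter tuple in the open disc with
    the same energy ([captured_energy_filter]), and appending zeros to restore
    the length n can only increase the energy ([captured_energy_cat]).  The
    resulting tuple in D^n captures at least as much as any other.

    On Taylor coefficients, multiplication by a Blaschke factor is the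
    input-output map of a linear system given by a unitary 2 x 2 matrix.
    Conservation of energy ([colligation_unitary]) yields isometry,
    orthonormality of the system ([tm_coef_orthonormal]) and the bound on the
    closed polydisc ([tm_coef_energy_le]) in one stroke.

    The other ingredient is that the inner product, defined by integrating
    radial boundary values, equals the l^2 inner product of Taylor
    coefficients ([hardy_innerE]); it contains Fatou's theorem.  The Poisson
    average of a function is bounded by its centred averages, because the
    kernel is decreasing ([poisson_integral_le]); hence all dilations of a
    trigonometric polynomial are dominated by its Hardy-Littlewood maximal
    function ([dilate_le_HL_maximal]).  The weak type inequality passes to
    power series ([radial_ext_weak_type]) and, applied to tails, gives radial
    limits almost everywhere ([radial_cvg_ae]).  Fatou's lemma bounds the
    energy of the boundary function ([boundary_energy_le]); applying this
    bound to tails gives the Parseval identity ([boundary_energyE]), and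
    polarisation gives the inner product ([boundary_inner]). *)

(** * Averages against the Poisson kernel *)

Section poisson.
Variable R : realType.
Set Implicit Arguments. Unset Strict Implicit.
Implicit Types (r s t : R) (k N : nat).
Local Notation mu := (@lebesgue_measure R).

Lemma continuous_derivable1 (f : R -> R) (df : R -> R) :
  (forall x : R, is_derive x 1 f (df x)) -> continuous f.
Proof.
move=> dF x; apply: differentiable_continuous; apply/derivable1_diffP.
by have [] := dF x.
Qed.

Lemma Rintegral_derive (F f : R -> R) (a b : R) : a < b ->
  (forall x : R, is_derive x 1 F (f x)) -> continuous f ->
  \int[mu]_(x in `[a, b]) f x = F b - F a.
Proof.
move=> ab dF cf.
have cF := continuous_derivable1 dF.
rewrite /Rintegral (@continuous_FTC2 _ f F)//.
- by apply: continuous_subspaceT.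
- split.
  + by move=> x _; have [] := dF x.
  + exact: cvg_at_right_filter (cF a).
  + exact: cvg_at_left_filter (cF b).
- by move=> x _; rewrite derive1E; have [] := dF x.
Qed.

Lemma continuous_integrable (f : R -> R) (a b : R) : continuous f ->
  mu.-integrable `[a, b] (EFin \o f).
Proof.
move=> cf; apply: continuous_compact_integrable; first exact: segment_compact.
exact: continuous_subspaceT.
Qed.

Definition poisson_den r s : R := 1 - 2 * r * cos s + r ^+ 2.
Definition poisson_kernel r s : R := (1 - r ^+ 2) / poisson_den r s.

Lemma poisson_den_gt0 r s : 0 <= r < 1 -> 0 < poisson_den r s.
Proof.
move=> /andP[r0 r1]; have -> : poisson_den r s = (1 - r) ^+ 2 + 2 * r * (1 - cos s).
  by rewrite /poisson_den; ring.
rewrite ltr_wpDr// ?mulr_ge0 ?subr_ge0 ?cos_le1//.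
by rewrite exprn_gt0// subr_gt0.
Qed.

Lemma poisson_kernel_ge0 r s : 0 <= r < 1 -> 0 <= poisson_kernel r s.
Proof.
move=> r01; apply: divr_ge0; last exact/ltW/poisson_den_gt0.
by move/andP: r01 => [r0 r1]; rewrite subr_ge0 expr_le1// ltW.
Qed.

Lemma is_derive_poisson_kernel r s : 0 <= r < 1 ->
  is_derive s 1 (poisson_kernel r)
    (- (1 - r ^+ 2) * (2 * r * sin s) / poisson_den r s ^+ 2).
Proof.
move=> r01; have d0 : poisson_den r s != 0 by rewrite gt_eqF// poisson_den_gt0.
have D : is_derive s 1 (poisson_den r) (2 * r * sin s).
  rewrite /poisson_den; apply: is_derive_eq; rewrite /GRing.scale/=; ring.
have V := is_deriveV d0 D.
have := @is_deriveM _ _ (cst (1 - r ^+ 2)) _ s 1 _ _ (is_derive_cst _ _ _) V.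
move=> /is_derive_eq; apply.
by rewrite scaler0 addr0 /GRing.scale/=; field.
Qed.

Lemma continuous_poisson_kernel r : 0 <= r < 1 -> continuous (poisson_kernel r).
Proof. by move=> r01;
have dF s := is_derive_poisson_kernel s r01; exact: continuous_derivable1 dF.
Qed.

Lemma continuous_poisson_den r : continuous (poisson_den r).
Proof.
move=> x; apply: cvgD; last exact: cvg_cst.
apply: cvgB; first exact: cvg_cst.
apply: cvgM; first exact: cvg_cst.
exact: continuous_cos.
Qed.

Lemma continuous_cosM (a : R) : continuous (fun s : R => cos (a * s)).
Proof.
move=> x; apply: (@continuous_comp _ _ _ (fun s : R => a * s) cos).
  by apply: cvgM; [exact: cvg_cst|exact: cvg_id].
exact: continuous_cos.
Qed.

Lemma continuous_sinM (a : R) : continuous (fun s : R => sin (a * s)).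
Proof.
move=> x; apply: (@continuous_comp _ _ _ (fun s : R => a * s) sin).
  by apply: cvgM; [exact: cvg_cst|exact: cvg_id].
exact: continuous_sin.
Qed.

Definition poisson_moment r k :=
  \int[mu]_(s in `[0, pi]) (poisson_kernel r s * cos (k%:R * s)).

Lemma continuous_poisson_kernel_cos r k : 0 <= r < 1 ->
  continuous (fun s => poisson_kernel r s * cos (k%:R * s)).
Proof.
move=> r01 x; apply: cvgM; first exact: continuous_poisson_kernel.
exact: continuous_cosM.
Qed.

Lemma is_derive_sinM (a x : R) :
  is_derive x 1 (fun s : R => sin (a * s)) (a * cos (a * x)).
Proof.
apply: is_derive_eq.
by rewrite /GRing.scale/=; ring.
Qed.

Lemma is_derive_cosM (a x : R) :
  is_derive x 1 (fun s : R => cos (a * s)) (- (a * sin (a * x))).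
Proof.
apply: is_derive_eq.
by rewrite /GRing.scale/=; ring.
Qed.

Lemma sin_natMpi k : sin (k%:R * pi) = 0 :> R.
Proof.
elim: k => [|k IH]; first by rewrite mul0r sin0.
by rewrite -natr1 mulrDl mul1r sinDpi IH oppr0.
Qed.

Lemma Rintegral_cosS k : \int[mu]_(s in `[0, pi]) cos (k.+1%:R * s) = 0 :> R.
Proof.
pose F s : R := k.+1%:R^-1 * sin (k.+1%:R * s).
have dF (x : R) : is_derive x 1 F (cos (k.+1%:R * x)).
  have D := is_derive_sinM k.+1%:R x.
  have k0 : k.+1%:R != 0 :> R by rewrite pnatr_eq0.
  apply: is_derive_eq; rewrite /GRing.scale/=. by field.
rewrite (Rintegral_derive (pi_gt0 R) dF); last exact: continuous_cosM.
by rewrite /F sin_natMpi mulr0 mulr0 sin0 mulr0 subrr.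
Qed.

(** Multiplying the kernel by its denominator and using
    2 cos s cos (k+1)s = cos (k+2)s + cos ks gives a three-term relation
    between consecutive cosine multiples of the kernel. *)
Lemma poisson_kernel_cosE r s k : 0 <= r < 1 ->
  (1 + r ^+ 2) * (poisson_kernel r s * cos (k.+1%:R * s)) -
  r * (poisson_kernel r s * cos (k.+2%:R * s) + poisson_kernel r s * cos (k%:R * s)) =
  (1 - r ^+ 2) * cos (k.+1%:R * s).
Proof.
move=> r01; have d0 : poisson_den r s != 0 by rewrite gt_eqF// poisson_den_gt0.
have -> : k.+2%:R * s = k.+1%:R * s + s by rewrite -[k.+2%:R]natr1; ring.
have -> : k%:R * s = k.+1%:R * s - s by rewrite -[k.+1%:R]natr1; ring.
rewrite cosD cosB /poisson_kernel; have -> : r ^+ 2 = poisson_den r s - 1 +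
  2 * r * cos s.
  by rewrite /poisson_den; ring.
by field.
Qed.

(** Integrating [poisson_kernel_cosE] over [0, pi], where cos (k+1)s has
    mean zero. *)
Lemma poisson_moment_rec r k : 0 <= r < 1 ->
  (1 + r ^+ 2) * poisson_moment r k.+1 =
    r * (poisson_moment r k.+2 + poisson_moment r k).
Proof.
move=> r01; apply/eqP; rewrite -subr_eq0 /poisson_moment.
have I m : mu.-integrable `[0,
  pi] (EFin \o (fun s => poisson_kernel r s * cos (m%:R * s))).
  exact/continuous_integrable/continuous_poisson_kernel_cos.
rewrite -RintegralD// -!RintegralZl//; last first.
  apply: continuous_integrable => x.
  by apply: cvgD; exact: continuous_poisson_kernel_cos.
rewrite -RintegralB//; last 2 first.
  apply: continuous_integrable => x.
  by apply: cvgM; [exact: cvg_cst|exact: continuous_poisson_kernel_cos].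
  apply: continuous_integrable => x.
  by apply: cvgM; [exact: cvg_cst|apply: cvgD; exact: continuous_poisson_kernel_cos].
under eq_Rintegral do rewrite poisson_kernel_cosE//.
rewrite RintegralZl//; last exact/continuous_integrable/continuous_cosM.
by rewrite Rintegral_cosS mulr0.
Qed.

Lemma poisson_moment_rec0 r : 0 <= r < 1 ->
  (1 + r ^+ 2) * poisson_moment r 0 - 2 * r * poisson_moment r 1 = (1 - r ^+ 2) * pi.
Proof.
move=> r01; rewrite /poisson_moment.
have I m : mu.-integrable `[0,
  pi] (EFin \o (fun s => poisson_kernel r s * cos (m%:R * s))).
  exact/continuous_integrable/continuous_poisson_kernel_cos.
rewrite -!RintegralZl//.
rewrite -RintegralB//; last 2 first.
  apply: continuous_integrable => x.
  by apply: cvgM; [exact: cvg_cst|exact: continuous_poisson_kernel_cos].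
  apply: continuous_integrable => x.
  by apply: cvgM; [exact: cvg_cst|exact: continuous_poisson_kernel_cos].
transitivity (\int[mu]_(s in `[0, pi]) (1 - r ^+ 2)).
  apply: eq_Rintegral => s _; rewrite mul0r mul1r cos0 mulr1.
  have d0 : poisson_den r s != 0 by rewrite gt_eqF// poisson_den_gt0.
  rewrite /poisson_kernel; have -> : r ^+ 2 = poisson_den r s - 1 + 2 * r * cos s.
    by rewrite /poisson_den; ring.
  by field.
rewrite Rintegral_cst//= lebesgue_measure_itv/= lte_fin pi_gt0//=.
by rewrite subr0.
Qed.

Lemma poisson_moment_le r k : 0 <= r < 1 -> `|poisson_moment r k| <= poisson_moment r 0.
Proof.
move=> r01; apply: le_trans; first apply: le_normr_Rintegral => //.
  exact/continuous_integrable/continuous_poisson_kernel_cos.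
apply: le_Rintegral => //.
- apply: continuous_integrable => x; apply: cvg_norm.
  exact: continuous_poisson_kernel_cos.
- exact/continuous_integrable/continuous_poisson_kernel_cos.
move=> s _; rewrite mul0r cos0 normrM ger0_norm ?poisson_kernel_ge0//.
rewrite ler_wpM2l ?poisson_kernel_ge0// ler_norml cos_le1 cos_geN1//.
Qed.

Lemma le0_of_geometric (r x C : R) : 0 <= r < 1 ->
  (forall k, x <= r ^+ k * C) -> x <= 0.
Proof.
move=> /andP[r0 r1] H.
have cv : (fun k => r ^+ k * C) @ \oo --> (0 : R).
  by rewrite -[0](mul0r C); apply: cvgMl; apply: cvg_expr; rewrite ger0_norm.
rewrite -(cvg_lim _ cv)//; apply: limr_ge; first exact: cvgP cv.
exact: nearW.
Qed.

(** The recurrence has characteristic roots r and 1/r.  The moments are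
    bounded by the zeroth one, so the growing solution is absent; this leaves
    a multiple of r^k, and the relation for k = 0 fixes the factor. *)
Lemma poisson_momentE r k : 0 <= r < 1 -> poisson_moment r k = pi * r ^+ k.
Proof.
move=> r01; have /andP[r0 r1] := r01.
(* D vanishes: r D(k+1) = D(k) with D bounded. *)
pose D k := poisson_moment r k.+1 - r * poisson_moment r k.
have rec j : D j = r * D j.+1.
  by rewrite /D; have := poisson_moment_rec j r01; move: (poisson_moment _ _) => a; lra.
have recn m j : D m = r ^+ j * D (m + j)%N.
  elim: j => [|j IH]; first by rewrite addn0 expr0 mul1r.
  by rewrite IH rec addnS exprSr mulrA.
have D0 m : D m = 0.
  apply/eqP; rewrite -normr_le0;
    apply: (@le0_of_geometric r _ (2 * poisson_moment r 0)) => // j.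
  rewrite (recn m j) normrM ger0_norm ?exprn_ge0// ler_wpM2l ?exprn_ge0//.
  rewrite (le_trans (ler_normB _ _))// normrM (ger0_norm r0).
  have := poisson_moment_le (m + j).+1 r01; have := poisson_moment_le (m + j) r01.
  have := normr_ge0 (poisson_moment r (m + j)); nra.
have E m : poisson_moment r m.+1 = r * poisson_moment r m.
  by apply/eqP; rewrite -subr_eq0; apply/eqP; exact: D0.
have E0 : poisson_moment r 0 = pi.
  have := poisson_moment_rec0 r01; rewrite E => H.
  have N : 1 - r ^+ 2 != 0 by rewrite gt_eqF// subr_gt0 expr_lt1.
  by apply: (mulfI N); rewrite -H; ring.
elim: k => [|k IH]; first by rewrite expr0 mulr1.
by rewrite E IH exprS; ring.
Qed.

(** On [0, pi] the kernel decreases, so the derivative of kernel times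
    (W s - 2 M s) is at least kernel times (w s - 2 M).  Integrating, the
    boundary term at pi is nonpositive by the bound on W pi, and the kernel
    has mass pi.  Hence a bound on the averages of w over all intervals
    [0, s] is inherited by its Poisson average. *)
Lemma poisson_integral_le (w W : R -> R) (r M : R) : 0 <= r < 1 ->
  continuous w -> (forall s : R, is_derive s 1 W (w s)) -> W 0 = 0 ->
  (forall s, 0 <= s <= pi -> W s <= 2 * M * s) ->
  \int[mu]_(s in `[0, pi]) (poisson_kernel r s * w s) <= 2 * M * pi.
Proof.
move=> r01 cw dW W0 WM; have /andP[r0 r1] := r01.
pose dp s := - (1 - r ^+ 2) * (2 * r * sin s) / poisson_den r s ^+ 2.
pose h s := poisson_kernel r s * (w s - 2 * M) + (W s - 2 * M * s) * dp s.
have cW : continuous W by exact: continuous_derivable1 dW.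
have cdp : continuous dp.
  move=> x; apply: cvgM.
    apply: cvgM; first exact: cvg_cst.
    by apply: cvgM; [exact: cvg_cst|exact: continuous_sin].
  apply: cvgV; first by rewrite expf_neq0// gt_eqF// poisson_den_gt0.
  by rewrite expr2; apply: cvgM; exact: continuous_poisson_den.
have cl : continuous (fun s => W s - 2 * M * s).
  move=> x; apply: cvgB; first exact: cW.
  by apply: cvgM; [exact: cvg_cst|exact: cvg_id].
have ch : continuous h.
  move=> x; apply: cvgD; apply: cvgM.
  - exact: continuous_poisson_kernel.
  - by apply: cvgB; [exact: cw|exact: cvg_cst].
  - exact: cl.
  - exact: cdp.
have dh (x : R) : is_derive x 1 (fun s => poisson_kernel r s * (W s - 2 * M * s)) (h x).
  have D1 := is_derive_poisson_kernel x r01; have D2 := dW x.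
  have D3 : is_derive x 1 (fun s : R => W s - 2 * M * s) (w x - 2 * M).
    by apply: is_derive_eq; rewrite /GRing.scale/=; ring.
  apply: is_derive_eq; rewrite /h /dp /GRing.scale/=. done.
have := Rintegral_derive (pi_gt0 R) dh ch; rewrite W0 mulr0 subr0 mulr0 subr0 => hE.
have I1 : mu.-integrable `[0, pi] (EFin \o (fun s => poisson_kernel r s * w s)).
  apply: continuous_integrable => x.
  by apply: cvgM; [exact: continuous_poisson_kernel|exact: cw].
have I2 : mu.-integrable `[0,
  pi] (EFin \o (fun s => 2 * M * (poisson_kernel r s * cos (0%:R * s)))).
  apply: continuous_integrable => x.
  by apply: cvgM; [exact: cvg_cst|exact: continuous_poisson_kernel_cos].
have : \int[mu]_(s in `[0, pi]) (poisson_kernel r s * w s -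
  2 * M * (poisson_kernel r s * cos (0%:R * s))) <=
   \int[mu]_(s in `[0, pi]) h s.
  apply: le_Rintegral => //.
  - apply: continuous_integrable => x; apply: cvgB.
      by apply: cvgM; [exact: continuous_poisson_kernel|exact: cw].
    by apply: cvgM; [exact: cvg_cst|exact: continuous_poisson_kernel_cos].
  - exact: continuous_integrable.
  move=> s /=; rewrite in_itv/= => s0pi; rewrite mul0r cos0 mulr1 /h mulrBr.
  rewrite [2 * M * _]mulrC lerDl mulr_le0//; first by rewrite subr_le0 WM.
  rewrite /dp -mulrA mulNr oppr_le0 mulr_ge0//.
    by rewrite subr_ge0 expr_le1// ltW.
  rewrite divr_ge0// ?sqr_ge0// mulr_ge0//; first by rewrite mulr_ge0.
  exact: sin_ge0_pi.
rewrite hE RintegralB// RintegralZl//;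
  last exact/continuous_integrable/continuous_poisson_kernel_cos.
rewrite [X in _ - _ * X](_ : _ = pi);
  last by rewrite -/(poisson_moment r 0) poisson_momentE// expr0 mulr1.
have : poisson_kernel r pi * (W pi - 2 * M * pi) <= 0.
  by rewrite mulr_ge0_le0 ?poisson_kernel_ge0// subr_le0 WM// lexx pi_ge0.
lra.
Qed.

End poisson.

(** * Trigonometric polynomials and the maximal function *)

Section trigpoly.
Variable R : realType.
Set Implicit Arguments. Unset Strict Implicit.
Implicit Types (r s t x : R) (k N : nat) (a b : nat -> R).
Local Notation mu := (@lebesgue_measure R).

(** The real part of c_k e^(ikt) for c_k = a k + i b k.  Its imaginary part is
    the same expression for the pair (b, - a), which lets the analysis on the
    circle be carried out for real functions only. *)
Definition trig_term a b k t : R := a k * cos (k%:R * t) - b k * sin (k%:R * t).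
Definition trig_poly a b N t : R := \sum_(0 <= k < N) trig_term a b k t.

Lemma continuous_trig_term a b k : continuous (trig_term a b k).
Proof.
move=> x; apply: cvgB; apply: cvgM; first exact: cvg_cst.
- exact: continuous_cosM.
- exact: cvg_cst.
- exact: continuous_sinM.
Qed.

Lemma continuous_bigsum (F : nat -> R -> R) N :
  (forall k, continuous (F k)) -> continuous (fun x => \sum_(0 <= k < N) F k x).
Proof.
move=> cF; elim: N => [|N IH] x.
  by under eq_fun do rewrite big_nil; exact: cvg_cst.
under eq_fun do rewrite big_nat_recr//=.
by apply: cvgD; [exact: IH|exact: cF].
Qed.

Lemma continuous_trig_poly a b N : continuous (trig_poly a b N).
Proof. exact/continuous_bigsum/continuous_trig_term. Qed.

Lemma is_derive_bigsum (F : nat -> R -> R) (f : nat -> R) N x :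
  (forall k, is_derive x 1 (F k) (f k)) ->
  is_derive x 1 (fun y => \sum_(0 <= k < N) F k y) (\sum_(0 <= k < N) f k).
Proof.
move=> dF; elim: N => [|N IH].
  under eq_fun do rewrite big_nil.
  by rewrite big_nil; exact: is_derive_cst.
under eq_fun do rewrite big_nat_recr//=.
by rewrite big_nat_recr//=; exact: is_deriveD.
Qed.

Definition trig_primitive a b k t : R :=
  if k == 0%N then a 0%N * t
  else k%:R^-1 * (a k * sin (k%:R * t) + b k * cos (k%:R * t)).

Lemma is_derive_trig_primitive a b k x : is_derive x 1 (trig_primitive a b k)
  (trig_term a b k x).
Proof.
rewrite /trig_primitive /trig_term; have [->|k0] := eqVneq k 0%N.
  rewrite mul0r cos0 sin0 mulr0 subr0 mulr1.
  by apply: is_derive_eq; rewrite /GRing.scale/= mulr1.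
have D1 := is_derive_sinM k%:R x; have D2 := is_derive_cosM k%:R x.
have k1 : k%:R != 0 :> R by rewrite pnatr_eq0.
by apply: is_derive_eq; rewrite /GRing.scale/=; field.
Qed.

Lemma Rintegral_trig_poly a b N (p q : R) : p < q ->
  \int[mu]_(x in `[p, q]) trig_poly a b N x =
  \sum_(0 <= k < N) trig_primitive a b k q - \sum_(0 <= k < N) trig_primitive a b k p.
Proof.
move=> pq; have D x := is_derive_bigsum N (fun k => is_derive_trig_primitive a b k x).
by rewrite -(Rintegral_derive pq D)//; exact: continuous_trig_poly.
Qed.

Lemma Rintegral_poisson_kernel_cos r (be : nat -> R) N : 0 <= r < 1 ->
  \int[mu]_(s in `[0, pi])
     (poisson_kernel r s * \sum_(0 <= k < N) be k * cos (k%:R * s)) =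
  pi * \sum_(0 <= k < N) be k * r ^+ k.
Proof.
move=> r01; elim: N => [|N IH].
  under eq_Rintegral do rewrite big_nil mulr0.
  by rewrite Rintegral_cst// mul0r big_nil mulr0.
under eq_Rintegral do rewrite big_nat_recr//= mulrDr.
rewrite RintegralD//; last 2 first.
- apply: continuous_integrable => x; apply: cvgM;
  first exact: continuous_poisson_kernel.
  apply: continuous_bigsum => k y; apply: cvgM; first exact: cvg_cst.
  exact: continuous_cosM.
- apply: continuous_integrable => x; apply: cvgM;
  first exact: continuous_poisson_kernel.
  by apply: cvgM; [exact: cvg_cst|exact: continuous_cosM].
rewrite IH big_nat_recr//= mulrDr; congr (_ + _).
under eq_Rintegral do rewrite mulrCA.
rewrite RintegralZl//; last exact/continuous_integrable/continuous_poisson_kernel_cos.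
by rewrite -/(poisson_moment r N) poisson_momentE//; ring.
Qed.

Definition dilate r a k : R := r ^+ k * a k.

(** With w s = u (t + s) + u (t - s), the Poisson average of w is 2 pi times
    the dilated polynomial at t, and the primitive of w vanishing at 0 is the
    integral of u over [t - s, t + s]; so [poisson_integral_le] turns bounds
    on centred averages of u into a bound for every dilation of u. *)
Lemma dilate_trig_poly_le a b N r t M : 0 <= r < 1 ->
  (forall s, 0 < s <= pi ->
     \int[mu]_(x in `[t - s, t + s]) trig_poly a b N x <= 2 * M * s) ->
  trig_poly (dilate r a) (dilate r b) N t <= M.
Proof.
move=> r01 H.
(* w s = u (t + s) + u (t - s), expanded by the addition formulas. *)
pose w s := \sum_(0 <= k < N) (2 * trig_term a b k t) * cos (k%:R * s).
pose G x := \sum_(0 <= k < N) trig_primitive a b k x.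
pose W s := G (t + s) - G (t - s).
have D x := is_derive_bigsum N (fun k => is_derive_trig_primitive a b k x).
have cw : continuous w.
  apply: continuous_bigsum => k y; apply: cvgM; first exact: cvg_cst.
  exact: continuous_cosM.
have dW s : is_derive s 1 W (w s).
  have D1 : is_derive s 1 (fun s => G (t + s)) (trig_poly a b N (t + s)).
    have E : is_derive s 1 (fun s : R => t + s) 1.
      by apply: is_derive_eq; ring.
    have := is_derive1_comp (D (t + s)) E; rewrite mulr1; exact.
  have D2 : is_derive s 1 (fun s => G (t - s)) (- trig_poly a b N (t - s)).
    have E : is_derive s 1 (fun s : R => t - s) (-1).
      by apply: is_derive_eq; ring.
    have := @is_derive1_comp R G (fun s => t - s) s _ _ (D _) E; rewrite mulrN1; exact.
  have := is_deriveB D1 D2; move=> /is_derive_eq; apply.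
  rewrite opprK /trig_poly -big_split/=; apply: eq_bigr => k _.
  by rewrite /trig_term mulrDr mulrBr cosD cosB sinD sinB; ring.
have := @poisson_integral_le R w W r M r01 cw dW.
rewrite Rintegral_poisson_kernel_cos//.
have -> : \sum_(0 <= k < N) 2 * trig_term a b k t * r ^+ k =
  2 * trig_poly (dilate r a) (dilate r b) N t.
  by rewrite /trig_poly big_distrr/=; apply: eq_bigr => k _;
    rewrite /trig_term /dilate; ring.
move=> P; have := pi_gt0 R => pi0.
have : pi * (2 * trig_poly (dilate r a) (dilate r b) N t) <= 2 * M * pi.
  apply: P; first by rewrite /W addr0 subr0 subrr.
  move=> s /andP[s0 spi]; have [->|sn0] := eqVneq s 0.
    by rewrite /W addr0 subr0 subrr mulr0.
  have {}s0 : 0 < s by rewrite lt_neqAle eq_sym sn0.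
  rewrite /W /G -Rintegral_trig_poly; first by apply: H; rewrite s0.
  by rewrite ltrBlDr -addrA ltrDl addr_gt0.
by rewrite (_ : 2 * M * pi = pi * (2 * M)) ?ler_pM2l//; ring.
Qed.

(** Says, through the integer frequencies, that q - p is a multiple of 2 pi. *)
Definition whole_periods (p q : R) :=
  forall j : nat, cos (j%:R * q) = cos (j%:R * p) /\ sin (j%:R * q) = sin (j%:R * p).

Lemma Rintegral_trig_term0 a b k (p q : R) : p < q -> whole_periods p q -> (0 < k)%N ->
  \int[mu]_(x in `[p, q]) trig_term a b k x = 0.
Proof.
move=> pq per k0; rewrite (Rintegral_derive pq (fun x =>
  is_derive_trig_primitive a b k x)).
  by rewrite /trig_primitive gtn_eqF//; have [-> ->] := per k; rewrite subrr.
exact: continuous_trig_term.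
Qed.

Definition opp_seq a k : R := - a k.

(** This is Re (c_k conj(c_m) e^(i(k-m)t)), a single harmonic of nonzero
    frequency m - k. *)
Lemma trig_term_mulD a b k m x : (k < m)%N ->
  trig_term a b k x * trig_term a b m x +
    trig_term b (opp_seq a) k x * trig_term b (opp_seq a) m x =
  trig_term (fun=> a k * a m + b k * b m) (fun=> a k * b m - b k * a m) (m - k) x.
Proof.
move=> km; rewrite /trig_term /opp_seq natrB; last exact: ltnW.
by rewrite [(m%:R - k%:R) * x]mulrBl cosB sinB; ring.
Qed.

Lemma trig_term_sqrD a b k x :
  trig_term a b k x ^+ 2 + trig_term b (opp_seq a) k x ^+ 2 = a k ^+ 2 + b k ^+ 2.
Proof.
rewrite /trig_term /opp_seq; transitivity ((a k ^+ 2 + b k ^+ 2) *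
  (cos (k%:R * x) ^+ 2 + sin (k%:R * x) ^+ 2)); first by ring.
by rewrite cos2Dsin2 mulr1.
Qed.

Lemma Rintegral_cross_term0 a b N m (p q : R) : p < q -> whole_periods p q ->
  (N <= m)%N ->
  \int[mu]_(x in `[p, q]) (trig_poly a b N x * trig_term a b m x +
     trig_poly b (opp_seq a) N x * trig_term b (opp_seq a) m x) = 0.
Proof.
move=> pq per; elim: N => [_|N IH Nm].
  rewrite (_ : (fun x => _) = cst 0) ?Rintegral_cst ?mul0r//.
  by apply/funext => x; rewrite /trig_poly !big_nil !mul0r addr0.
rewrite (_ : (fun x => _) = (fun x => (trig_poly a b N x * trig_term a b m x +
     trig_poly b (opp_seq a) N x * trig_term b (opp_seq a) m x) +
  trig_term (fun=> a N * a m + b N * b m) (fun=> a N * b m - b N * a m) (m - N) x));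
    last first.
  by apply/funext => x; rewrite -trig_term_mulD// /trig_poly !big_nat_recr//=; ring.
rewrite RintegralD//.
- by rewrite IH ?(ltnW Nm)// Rintegral_trig_term0 ?addr0// subn_gt0.
- apply: continuous_integrable => x; apply: cvgD; apply: cvgM;
    (exact: continuous_trig_poly || exact: continuous_trig_term).
- exact/continuous_integrable/continuous_trig_term.
Qed.

Lemma continuous_sqr (f : R -> R) : continuous f -> continuous (fun x => f x ^+ 2).
Proof.
move=> cf; rewrite (_ : (fun x => _) = (fun x => f x * f x)).
  by move=> x; apply: cvgM; exact: cf.
by apply/funext => x; rewrite expr2.
Qed.

Lemma parseval_trig_poly a b N (p q : R) : p < q -> whole_periods p q ->
  \int[mu]_(x in `[p, q]) (trig_poly a b N x ^+ 2 + trig_poly b (opp_seq a) N x ^+ 2) =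
  (q - p) * \sum_(0 <= k < N) (a k ^+ 2 + b k ^+ 2).
Proof.
move=> pq per; elim: N => [|N IH].
  rewrite (_ : (fun x => _) = cst 0) ?Rintegral_cst ?mul0r ?big_nil ?mulr0//.
  by apply/funext => x; rewrite /trig_poly !big_nil !expr0n addr0.
rewrite (_ : (fun x => _) =
  (fun x => (trig_poly a b N x ^+ 2 + trig_poly b (opp_seq a) N x ^+ 2)
  + (2 * (trig_poly a b N x * trig_term a b N x +
    trig_poly b (opp_seq a) N x * trig_term b (opp_seq a) N x)
  + (a N ^+ 2 + b N ^+ 2)))); last first.
  by apply/funext => x; rewrite -(trig_term_sqrD a b N x) /trig_poly !big_nat_recr//=;
    ring.
have c1 : continuous (fun x => trig_poly a b N x ^+ 2 +
  trig_poly b (opp_seq a) N x ^+ 2).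
  by move=> x; apply: cvgD; apply: continuous_sqr; exact: continuous_trig_poly.
have c2 : continuous (fun x => trig_poly a b N x * trig_term a b N x +
   trig_poly b (opp_seq a) N x * trig_term b (opp_seq a) N x).
  move=> x; apply: cvgD; apply: cvgM;
    (exact: continuous_trig_poly || exact: continuous_trig_term).
have c3 : continuous (fun x => 2 * (trig_poly a b N x * trig_term a b N x +
   trig_poly b (opp_seq a) N x * trig_term b (opp_seq a) N x)).
  by move=> x; apply: cvgM; [exact: cvg_cst|exact: c2].
rewrite RintegralD//; last 2 first.
- exact/continuous_integrable/c1.
- by apply: continuous_integrable => x; apply: cvgD; [exact: c3|exact: cvg_cst].
rewrite IH RintegralD//; last 2 first.
- exact/continuous_integrable/c3.
- by apply: continuous_integrable => x; exact: cvg_cst.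
rewrite RintegralZl//; last exact/continuous_integrable/c2.
rewrite Rintegral_cross_term0// mulr0 add0r Rintegral_cst//= lebesgue_measure_itv/=
  lte_fin pq/=.
by rewrite big_nat_recr//=; ring.
Qed.

Lemma whole_periods_2pi (p : R) m : whole_periods p (p + m%:R * (2 * pi)).
Proof.
move=> j; rewrite mulrDr.
have -> : j%:R * (m%:R * (2 * pi)) = (j * m)%:R * (2 * pi) :> R by rewrite natrM mulrA.
elim: (j * m)%N => [|n [IHc IHs]]; first by rewrite mul0r addr0.
have -> : j%:R * p + n.+1%:R * (2 * pi) = j%:R * p + n%:R * (2 * pi) + pi *+ 2 :> R.
  by rewrite -natr1 -mulr_natl; ring.
by rewrite cosD2pi sinD2pi IHc IHs.
Qed.

(** From |u| <= u^2 / (2 eta) + eta / 2 and Parseval. *)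
Lemma Rintegral_norm_trig_poly_le a b N (p q eta : R) : p < q -> whole_periods p q ->
  0 < eta ->
  \sum_(0 <= k < N) (a k ^+ 2 + b k ^+ 2) <= eta ^+ 2 ->
  \int[mu]_(x in `[p, q]) `|trig_poly a b N x| <= (q - p) * eta.
Proof.
move=> pq per e0 H.
have c1 : continuous (fun x => trig_poly a b N x ^+ 2 +
  trig_poly b (opp_seq a) N x ^+ 2).
  by move=> x; apply: cvgD; apply: continuous_sqr; exact: continuous_trig_poly.
have c2 : continuous (fun x =>
  (2 * eta)^-1 * (trig_poly a b N x ^+ 2 + trig_poly b (opp_seq a) N x ^+ 2)).
  by move=> x; apply: cvgM; [exact: cvg_cst|exact: c1].
apply: (@le_trans _ _ (\int[mu]_(x in `[p, q])
  ((2 * eta)^-1 * (trig_poly a b N x ^+ 2 + trig_poly b (opp_seq a) N x ^+ 2) +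
    eta / 2))).
  apply: le_Rintegral => //.
  - by apply: continuous_integrable => x; apply: cvg_norm; exact: continuous_trig_poly.
  - by apply: continuous_integrable => x; apply: cvgD; [exact: c2|exact: cvg_cst].
  move=> x _; rewrite -(@ler_pM2l _ (2 * eta)); last by rewrite mulr_gt0.
  rewrite mulrDr mulrA divff ?mul1r; last by rewrite gt_eqF// mulr_gt0.
  have := sqr_ge0 (trig_poly b (opp_seq a) N x).
  have : trig_poly a b N x ^+ 2 =
    `|trig_poly a b N x| ^+ 2 by rewrite real_normK// num_real.
  by have := sqr_ge0 (`|trig_poly a b N x| - eta); move: (trig_poly _ _ _ _ ^+ 2) =>
    A; nra.
rewrite RintegralD//; last 2 first.
- exact/continuous_integrable/c2.
- by apply: continuous_integrable => x; exact: cvg_cst.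
rewrite Rintegral_cst//= RintegralZl//; last exact/continuous_integrable/c1.
rewrite parseval_trig_poly// lebesgue_measure_itv/= lte_fin pq/=.
have qp : 0 < q - p by rewrite subr_gt0.
have -> : (q - p) * eta = (2 * eta)^-1 * ((q - p) * eta ^+ 2) + eta / 2 * (q - p).
  by field; rewrite gt_eqF.
rewrite lerD2r ler_pM2l; last by rewrite invr_gt0 mulr_gt0.
by rewrite ler_pM2l.
Qed.

(** Every interval of radius at most pi centred in [0, 2 pi] lies in
    [- pi, 3 pi], so truncating there does not change the averages that
    matter and makes the function integrable on the line. *)
Definition window a b N : R -> R := (fun x => trig_poly a b N x) \_ (`[- pi, 3 * pi]).

Lemma window_locally_integrable a b N : locally_integrable [set: R] (window a b N).
Proof.
apply: integrable_locally_restrict => //; apply: continuous_integrable.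
exact: continuous_trig_poly.
Qed.

Lemma centered_integral_le a b N t M s : (0 <= t <= 2 * pi) -> 0 < s <= pi ->
  (HL_maximal (window a b N) t <= M%:E)%E ->
  \int[mu]_(x in `[t - s, t + s]) `|trig_poly a b N x| <= 2 * M * s.
Proof.
move=> t02 /andP[s0 spi] HM.
have sub : `[t - s, t + s] `<=` `[- pi, 3 * pi].
  move=> x /=; rewrite !in_itv/= => /andP[x1 x2]; move/andP: t02 => [t0 t2].
  by apply/andP; split; lra.
have : (iavg (window a b N) (ball t s) <= M%:E)%E.
  apply: le_trans HM; apply: ereal_sup_ubound; exists s => //.
  by rewrite /= in_itv/= s0.
have c1 : continuous (fun x => `|trig_poly a b N x|).
  by move=> x; apply: cvg_norm; exact: continuous_trig_poly.
have -> : (iavg (window a b N) (ball t s) =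
  ((s *+ 2)^-1 * \int[mu]_(x in `[t - s, t + s]) `|trig_poly a b N x|)%:E)%E.
  rewrite /iavg lebesgue_measure_ball ?ltW// inver gt_eqF ?mulrn_wgt0//.
  rewrite EFinM; congr (_ * _)%E.
  rewrite /Rintegral fineK; last first.
    by apply: integrable_fin_num => //; exact: continuous_integrable.
  rewrite ball_itv [RHS]integral_itv_bndoo.
    apply: eq_integral => x; rewrite inE => xts; rewrite /window patchE mem_set//.
    by apply: sub; apply: subset_itv_oo_cc.
  apply/measurable_EFinP/measurable_funTS.
  exact: continuous_measurable_fun.
rewrite lee_fin mulrC ler_pdivrMr ?mulrn_wgt0// => /le_trans; apply.
by rewrite -mulr_natl; lra.
Qed.

Lemma dilateN r a : dilate r (opp_seq a) = opp_seq (dilate r a).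
Proof. by apply/funext => k; rewrite /dilate /opp_seq mulrN. Qed.

Lemma trig_polyN a b N x : trig_poly (opp_seq a) (opp_seq b) N x = - trig_poly a b N x.
Proof.
rewrite /trig_poly -sumrN; apply: eq_bigr => k _; rewrite /trig_term /opp_seq; ring.
Qed.

Lemma dilate_le_HL_maximal a b N t M r : (0 <= t <= 2 * pi) -> 0 <= r < 1 ->
  (HL_maximal (window a b N) t <= M%:E)%E ->
  `|trig_poly (dilate r a) (dilate r b) N t| <= M.
Proof.
move=> t02 r01 HM.
have c0 : continuous (fun x => trig_poly a b N x) by exact: continuous_trig_poly.
have c1 : continuous (fun x => `|trig_poly a b N x|).
  by move=> x; apply: cvg_norm; exact: continuous_trig_poly.
have cN : continuous (fun x =>
  trig_poly (opp_seq a) (opp_seq b) N x) by exact: continuous_trig_poly.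
rewrite ler_norml; apply/andP; split.
  rewrite lerNl -trig_polyN -!dilateN; apply: dilate_trig_poly_le => // s s0.
  apply: le_trans (centered_integral_le t02 s0 HM); apply: le_Rintegral => //.
  - exact: continuous_integrable.
  - exact: continuous_integrable.
  by move=> x _; rewrite trig_polyN -normrN ler_norm.
apply: dilate_trig_poly_le => // s s0.
apply: le_trans (centered_integral_le t02 s0 HM); apply: le_Rintegral => //.
- exact: continuous_integrable.
- exact: continuous_integrable.
by move=> x _; exact: ler_norm.
Qed.

(** The weak type (1,1) maximal inequality, with the L^1 norm controlled by
    the energy: 12 = 3 * 4, where 3 is the Vitali constant and 4 pi the length
    of the window. *)
Lemma HL_maximal_window_weak a b N la eta : 0 < la -> 0 < eta ->
  \sum_(0 <= k < N) (a k ^+ 2 + b k ^+ 2) <= eta ^+ 2 ->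
  (mu [set t | HL_maximal (window a b N) t > la%:E] <= (12 * pi * eta / la)%:E)%E.
Proof.
move=> la0 e0 H.
have c1 : continuous (fun x => `|trig_poly a b N x|).
  by move=> x; apply: cvg_norm; exact: continuous_trig_poly.
apply: le_trans (maximal_inequality (window_locally_integrable a b N) la0) _.
rewrite [X in (_ * X)%E](_ : _ =
  (\int[mu]_(x in `[- pi, 3 * pi]) `|trig_poly a b N x|)%:E).
  rewrite -EFinM lee_fin [leRHS](_ : _ = 3 / la * (4 * pi * eta)); last by ring.
  rewrite ler_pM2l ?divr_gt0//.
  have pq : - pi < 3 * pi :> R by have := pi_gt0 R; lra.
  have per : @whole_periods (- pi) (3 * pi).
    have -> : 3 * pi = - pi + 2%:R * (2 * pi) :> R by ring.
    exact: whole_periods_2pi.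
  apply: le_trans (Rintegral_norm_trig_poly_le pq per e0 H) _.
  by rewrite ler_pM2r// ; lra.
rewrite /Rintegral fineK; last first.
  by apply: integrable_fin_num => //; exact: continuous_integrable.
rewrite [RHS]integral_mkcond; apply: eq_integral => x _.
by rewrite /window !patchE; case: ifP => // _; rewrite /= normr0.
Qed.

Lemma measurable_HL_window a b N la :
  measurable [set t | (HL_maximal (window a b N) t > la%:E)%E].
Proof.
rewrite -[X in measurable X]setTI; apply: emeasurable_fun_o_infty => //.
by apply: measurable_HL_maximal; exact: window_locally_integrable.
Qed.

End trigpoly.

(** * Radial limits of square-summable power series *)

Section fatou.
Variable R : realType.
Set Implicit Arguments. Unset Strict Implicit.
Implicit Types (r s t x : R) (k N : nat) (a b : nat -> R).
Local Notation mu := (@lebesgue_measure R).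

(** A bound on all partial sums rather than a limit, because it passes to
    tails and dilations without any convergence argument. *)
Definition energy_le a b (A : R) :=
  forall N, \sum_(0 <= k < N) (a k ^+ 2 + b k ^+ 2) <= A.

Definition radial_partial a b r N t := trig_poly (dilate r a) (dilate r b) N t.

(** The real part of f (r e^(it)) for f = sum_k (a k + i b k) z^k; the
    imaginary part is obtained from the pair (b, - a). *)
Definition radial_ext a b r t : R := limn (fun N => radial_partial a b r N t).

Lemma energy_le_coef a b A k : energy_le a b A -> `|a k| <= A + 1 /\ `|b k| <= A + 1.
Proof.
move=> H.
have : a k ^+ 2 + b k ^+ 2 <= A.
  apply: le_trans (H k.+1); rewrite big_nat_recr//= lerDr sumr_ge0// => i _.
  by rewrite addr_ge0 ?sqr_ge0.
have := sqr_ge0 (a k); have := sqr_ge0 (b k).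
have -> : a k ^+ 2 = `|a k| ^+ 2 by rewrite real_normK// num_real.
have -> : b k ^+ 2 = `|b k| ^+ 2 by rewrite real_normK// num_real.
have := normr_ge0 (a k); have := normr_ge0 (b k).
by move: `|a k| `|b k| => p q q0 p0 q2 p2 pqA; split; nra.
Qed.

Lemma energy_le_conj a b A : energy_le a b A -> energy_le b (opp_seq a) A.
Proof.
move=> H N; apply: le_trans (H N); rewrite le_eqVlt; apply/orP; left; apply/eqP.
by apply: eq_bigr => k _; rewrite /opp_seq sqrrN addrC.
Qed.

Lemma trig_term_dilate_le a b C r k t : 0 <= r -> `|a k| <= C -> `|b k| <= C ->
  `|trig_term (dilate r a) (dilate r b) k t| <= 2 * C * r ^+ k.
Proof.
move=> r0 aC bC; rewrite /trig_term /dilate.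
have C0 : 0 <= C by apply: le_trans aC.
have rk : 0 <= r ^+ k by rewrite exprn_ge0.
have c1 : `|cos (k%:R * t)| <= 1 by rewrite ler_norml cos_le1 cos_geN1.
have s1 : `|sin (k%:R * t)| <= 1 by rewrite ler_norml sin_le1 sin_geN1.
rewrite (le_trans (ler_normB _ _))// !normrM (ger0_norm rk) -!mulrA -mulrDr.
rewrite (mulrC _ (r ^+ k)) mulrCA ler_wpM2l// mulr2n mulrDl mul1r.
by apply: lerD; rewrite -[leRHS]mulr1; apply: ler_pM.
Qed.

Lemma sum_geometric_le r N n : 0 <= r < 1 ->
  \sum_(N <= k < n) r ^+ k <= r ^+ N / (1 - r).
Proof.
move=> /andP[r0 r1]; have d0 : 0 < 1 - r by rewrite subr_gt0.
rewrite ler_pdivlMr//.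
have [nN|Nn] := leqP n N.
  by rewrite big_geq// mul0r exprn_ge0.
suff -> : (\sum_(N <= k < n) r ^+ k) * (1 - r) = r ^+ N - r ^+ n.
  by rewrite lerBlDr lerDl exprn_ge0.
elim: n Nn => // n IH; rewrite ltnS leq_eqVlt => /predU1P[<-|Nn].
  by rewrite big_nat1 exprS; ring.
by rewrite big_nat_recr//= ?(ltnW Nn)// mulrDl IH// exprS; ring.
Qed.

Lemma radial_partial_dist a b A r t N n : 0 <= r < 1 -> energy_le a b A -> (N <= n)%N ->
  `|radial_partial a b r n t - radial_partial a b r N t| <=
    2 * (A + 1) / (1 - r) * r ^+ N.
Proof.
move=> r01 H Nn; have /andP[r0 r1] := r01.
have -> : radial_partial a b r n t - radial_partial a b r N t =
  \sum_(N <= k < n) trig_term (dilate r a) (dilate r b) k t.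
  rewrite /radial_partial /trig_poly (@big_cat_nat _ _ _ N 0 n)//=.
  by rewrite [X in X - _]addrC addrK.
rewrite (le_trans (ler_norm_sum _ _ _))//.
apply: (@le_trans _ _ (\sum_(N <= k < n) 2 * (A + 1) * r ^+ k)).
  apply: ler_sum => k _; have [a1 b1] := energy_le_coef k H; exact: trig_term_dilate_le.
rewrite -big_distrr/= -[leRHS]mulrA ler_wpM2l//.
  have [a1 _] := energy_le_coef 0 H; rewrite mulr_ge0//; exact: le_trans a1.
by rewrite [leRHS]mulrC; exact: sum_geometric_le.
Qed.

Lemma radial_partial_cvg a b A r t : 0 <= r < 1 -> energy_le a b A ->
  radial_partial a b r ^~ t @ \oo --> radial_ext a b r t.
Proof.
move=> r01 H; have /andP[r0 r1] := r01.
suff : cvgn (series (fun k => trig_term (dilate r a) (dilate r b) k t)) by exact.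
apply: normed_cvg.
apply: (@series_le_cvg _ _ (fun k => 2 * (A + 1) * r ^+ k)).
- by move=> k /=.
- move=> k; have [a1 _] := energy_le_coef 0 H; apply: mulr_ge0; last exact: exprn_ge0.
  by apply: mulr_ge0 => //; exact: le_trans a1.
- by move=> k; have [a1 b1] := energy_le_coef k H; exact: trig_term_dilate_le.
- by apply: is_cvg_geometric_series; rewrite ger0_norm.
Qed.

Lemma radial_ext_dist a b A r t N : 0 <= r < 1 -> energy_le a b A ->
  `|radial_ext a b r t - radial_partial a b r N t| <= 2 * (A + 1) / (1 - r) * r ^+ N.
Proof.
move=> r01 H; have cv := @radial_partial_cvg a b A r t r01 H.
have cv2 : `|radial_partial a b r n t - radial_partial a b r N t| @[n --> \oo] -->
   `|radial_ext a b r t - radial_partial a b r N t|.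
  by apply: cvg_norm; apply: cvgB => //; exact: cvg_cst.
rewrite -(cvg_lim _ cv2)//; apply: limr_le; first exact: cvgP cv2.
by near=> n; apply: radial_partial_dist => //; near: n; exact: nbhs_infty_ge.
Unshelve. all: by end_near. Qed.

(** The same truncation order serves all t and all sequences of energy at most
    A; in particular a sequence and its conjugate. *)
Lemma radial_ext_approx A r e : 0 <= r < 1 -> 0 < e ->
  exists N, forall a b t, energy_le a b A ->
    `|radial_ext a b r t - radial_partial a b r N t| <= e.
Proof.
move=> r01 e0; have /andP[r0 r1] := r01.
have cv : (fun k => 2 * (A + 1) / (1 - r) * r ^+ k) @ \oo --> (0 : R).
  rewrite -[X in _ --> X](mulr0 (2 * (A + 1) / (1 - r))).
  by apply: cvgMr; apply: cvg_expr; rewrite ger0_norm.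
have [N _ HN] : \forall n \near \oo, 2 * (A + 1) / (1 - r) * r ^+ n <= e.
  by apply: (cvgr_le 0 cv).
by exists N => a b t H; apply: le_trans (HN N (leqnn N)); exact: radial_ext_dist.
Qed.

Lemma continuous_radial_ext a b A r : 0 <= r < 1 -> energy_le a b A ->
  continuous (radial_ext a b r).
Proof.
move=> r01 H x; apply/cvgrPdist_le => e e0.
have e3 : 0 < e / 3 by rewrite divr_gt0.
have [N HN0] := radial_ext_approx A r01 e3; have HN t := HN0 a b t H.
have := @continuous_trig_poly R (dilate r a) (dilate r b) N x.
move=> /cvgrPdist_le/(_ _ e3) cN; near=> y.
have -> : radial_ext a b r x - radial_ext a b r y =
  (radial_ext a b r x - radial_partial a b r N x) +
  (radial_partial a b r N x - radial_partial a b r N y) -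
    (radial_ext a b r y - radial_partial a b r N y) by ring.
have -> : e = e / 3 + e / 3 + e / 3 by field.
rewrite (le_trans (ler_normB _ _))// lerD// (le_trans (ler_normD _ _))// lerD//.
by near: y.
Unshelve. all: by end_near. Qed.

(** Each partial sum is dominated, for all radii at once, by the maximal
    function of a polynomial.  If t lies outside the lower limit of the
    corresponding superlevel sets, infinitely many partial sums are at most
    la, hence so is their limit; and the measure of a lower limit of sets
    does not exceed a common bound of their measures. *)
Lemma radial_ext_weak_type a b la eta : 0 < la -> 0 < eta -> energy_le a b (eta ^+ 2) ->
  exists B : set R, [/\ measurable B, (mu B <= (12 * pi * eta / la)%:E)%E &
    forall t r, 0 <= t <= 2 * pi -> ~ B t -> 0 <= r < 1 -> `|radial_ext a b r t| <= la].
Proof.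
move=> la0 e0 H.
pose Hn n := [set t | (HL_maximal (window a b n) t > la%:E)%E].
have mH n : measurable (Hn n) by exact: measurable_HL_window.
pose D m := \bigcap_(n in [set n | (m <= n)%N]) Hn n.
have mD m : measurable (D m) by apply: bigcap_measurable => //; exists m => /=.
have mB : measurable (\bigcup_m D m) by exact: bigcup_measurable.
exists (\bigcup_m D m); split => //.
  have cv : mu \o D @ \oo --> mu (\bigcup_m D m).
    apply: nondecreasing_cvg_mu => //.
    move=> m n mn; apply/subsetPset => t Dt k /= nk; apply: Dt => /=.
    exact: leq_trans nk.
  rewrite -(cvg_lim _ cv)//; apply: lime_le; first exact: cvgP cv.
  apply: nearW => m /=; apply: le_trans (HL_maximal_window_weak la0 e0 (H m)).
  apply: le_measure; rewrite ?inE//; [exact: mD|exact: mH|].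
  by move=> t Dt; exact: (Dt m (leqnn m)).
move=> t r t02 nB r01; have cv := @radial_partial_cvg a b _ r t r01 H.
rewrite leNgt; apply/negP => lt.
apply: nB.
have /cvgrPdist_lt/(_ (`|radial_ext a b r t| - la)) : radial_partial a b r n t @[n -->
  \oo] --> radial_ext a b r t by [].
rewrite subr_gt0 => /(_ lt)[m _ Hm].
exists m => //= n mn; rewrite /Hn/= ltNge; apply/negP => HM.
have := dilate_le_HL_maximal t02 r01 HM; have := Hm n mn.
rewrite -/(radial_partial a b r n t) /=.
have := lerB_dist (radial_ext a b r t) (radial_partial a b r n t); lra.
Qed.

(** The Cauchy condition at scale e for r near 1.  Written with all radii at
    once it defines a closed set of t, hence a measurable one. *)
Definition oscillation_le a b e d : set R :=
  [set t | forall r s, 0 <= r < 1 -> 0 <= s < 1 ->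
  1 - d <= r -> 1 - d <= s -> `|radial_ext a b r t - radial_ext a b s t| <= e].

Lemma closed_oscillation_le a b A e d : energy_le a b A ->
  closed (oscillation_le a b e d).
Proof.
move=> H.
have -> : oscillation_le a b e d =
  \bigcap_(p in [set p : R * R | [/\ 0 <= p.1 < 1, 0 <= p.2 < 1,
   1 - d <= p.1 & 1 - d <= p.2]])
   (fun t => `|radial_ext a b p.1 t - radial_ext a b p.2 t|) @^-1` [set x | x <= e].
  apply/seteqP; split=> [t Ht [r s] [/= r01 s01 dr ds]|t Ht r s r01 s01 dr ds].
    exact: Ht.
  exact: (Ht (r, s)).
apply: closed_bigI => -[r s] [/= r01 s01 _ _].
apply: (preimage_closed _ (@closed_le _ e)) => t _.
apply: cvg_norm; apply: cvgB; exact: (@continuous_radial_ext a b A).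
Qed.

Definition radial_cvg_set a b : set R :=
  \bigcap_m \bigcup_j oscillation_le a b m.+1%:R^-1 j.+1%:R^-1.

Lemma measurable_radial_cvg_set a b A : energy_le a b A ->
  measurable (radial_cvg_set a b).
Proof.
move=> H; apply: bigcap_measurable => [|m _]; first by exists 0%N.
apply: bigcup_measurable => j _; apply: closed_measurable.
exact: closed_oscillation_le H.
Qed.

Lemma exists_invS_lt (e : R) : 0 < e -> exists m : nat, m.+1%:R^-1 < e.
Proof.
move=> e0; have [m _ Hm] := near_infty_natSinv_lt (PosNum e0).
by exists m; exact: (Hm m (leqnn m)).
Qed.

Lemma radial_cvg_setP a b t : radial_cvg_set a b t <->
  cvg (radial_ext a b r t @[r --> 1^'-]).
Proof.
split=> [H|/cauchy_cvgP/cauchyP H m _].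
  apply/cauchy_cvgP/cauchyP => e e0; have [m me] := exists_invS_lt e0.
  have [j _ Hj] := H m I.
  (* Any radius past the threshold can serve as the centre of the Cauchy ball. *)
  pose r0 : R := Num.max 0 (1 - j.+1%:R^-1).
  exists (radial_ext a b r0 t).
  suff : \forall r \near 1^'-, ball (radial_ext a b r0 t) e (radial_ext a b r t) by [].
  near=> r; rewrite /ball/=; apply: le_lt_trans me; apply: Hj.
  - by rewrite /r0 le_max lexx/= gt_max ltr01/= ltrBlDr ltrDl invr_gt0.
  - apply/andP; split; near: r; last exact: nbhs_left_lt.
    exact: nbhs_left_ge.
  - by rewrite /r0 le_max lexx orbT.
  - near: r; apply: nbhs_left_ge; by rewrite ltrBlDr ltrDl invr_gt0.
have e0 : 0 < m.+1%:R^-1 / 2 :> R by rewrite divr_gt0.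
have [l] := H _ e0; rewrite /= nbhs_simpl /= => -[d /= d0 Hd].
have [j jd] := exists_invS_lt d0; exists j => // r s /andP[r0 r1] /andP[s0 s1] dr ds.
have near1 x : x < 1 -> 1 - j.+1%:R^-1 <= x -> `|l - radial_ext a b x t| <
  m.+1%:R^-1 / 2.
  move=> x1 dx; apply: Hd => //=; rewrite ger0_norm ?subr_ge0 ?ltW//.
  by apply: le_lt_trans jd; rewrite lerBlDr addrC -lerBlDr.
have -> : radial_ext a b r t - radial_ext a b s t = (l - radial_ext a b s t) -
  (l - radial_ext a b r t) by ring.
have := near1 r r1 dr; have := near1 s s1 ds => ls lr.
by rewrite (le_trans (ler_normB _ _))// (splitr m.+1%:R^-1) lerD// ltW.
Unshelve. all: by end_near. Qed.

Definition seq_tail N a k : R := if (k < N)%N then 0 else a k.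

Lemma sum_tail N n (f : nat -> R) : (N <= n)%N ->
  \sum_(0 <= k < n) (if (k < N)%N then 0 else f k) =
  \sum_(0 <= k < n) f k - \sum_(0 <= k < N) f k.
Proof.
move=> Nn; rewrite !(@big_cat_nat _ _ _ N 0 n)//=.
rewrite [X in _ = X - _]addrC addrK big_nat_cond big1 ?add0r.
  apply: eq_big_nat => k /andP[Nk _]; rewrite ltnNge Nk//.
by move=> k /andP[/andP[_ ->]].
Qed.

Lemma energy_tail_sum a b N n : (N <= n)%N ->
  \sum_(0 <= k < n) (seq_tail N a k ^+ 2 + seq_tail N b k ^+ 2) =
  \sum_(0 <= k < n) (a k ^+ 2 + b k ^+ 2) - \sum_(0 <= k < N) (a k ^+ 2 + b k ^+ 2).
Proof.
move=> Nn; rewrite -sum_tail//; apply: eq_bigr => k _.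
by rewrite /seq_tail; case: ifP => // _; rewrite expr0n addr0.
Qed.

(** The partial sums of the energy increase to a finite limit. *)
Lemma energy_le_tail a b A e : energy_le a b A -> 0 < e ->
  exists N, forall n, (N <= n)%N -> energy_le (seq_tail n a) (seq_tail n b) e.
Proof.
move=> H e0; pose S n := \sum_(0 <= k < n) (a k ^+ 2 + b k ^+ 2).
have ndS : {homo S : m n / (m <= n)%N >-> m <= n}.
  move=> m n mn; rewrite /S (@big_cat_nat _ _ _ m 0 n)//= lerDl sumr_ge0// => i _.
  by rewrite addr_ge0 ?sqr_ge0.
have cS : cvgn S.
  by apply: nondecreasing_is_cvgn => //; exists A => _ [n _ <-]; exact: H.
have [N _ HN] : \forall n \near \oo, limn S - S n <= e.
  have /cvgrPdist_le/(_ _ e0) := cS; apply: filterS => n.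
  by apply: le_trans; exact: ler_norm.
exists N => m Nm n; have [mn|nm] := leqP m n.
  rewrite energy_tail_sum// -/(S n) -/(S m); apply: le_trans (HN m Nm).
  by rewrite lerD2r; exact: nondecreasing_cvgn_le.
rewrite big_nat_cond big1 ?ltW// => k /andP[/andP[_ kn] _].
by rewrite /seq_tail (ltn_trans kn nm) expr0n addr0.
Qed.

Lemma radial_partial_tail a b N n r t : (N <= n)%N ->
  radial_partial (seq_tail N a) (seq_tail N b) r n t = radial_partial a b r n t -
    radial_partial a b r N t.
Proof.
move=> Nn; rewrite /radial_partial /trig_poly -sum_tail//; apply: eq_bigr => k _.
by rewrite /trig_term /dilate /seq_tail; case: ifP => // _; ring.
Qed.

Lemma radial_ext_tail a b A B N r t : 0 <= r < 1 -> energy_le a b A ->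
  energy_le (seq_tail N a) (seq_tail N b) B ->
  radial_ext a b r t = radial_partial a b r N t +
    radial_ext (seq_tail N a) (seq_tail N b) r t.
Proof.
move=> r01 H HT; have c1 := @radial_partial_cvg a b A r t r01 H.
have c2 := @radial_partial_cvg _ _ B r t r01 HT.
have c3 : radial_partial a b r n t - radial_partial a b r N t @[n --> \oo] -->
  radial_ext a b r t - radial_partial a b r N t.
  by apply: cvgB => //; exact: cvg_cst.
suff : radial_ext (seq_tail N a) (seq_tail N b) r t = radial_ext a b r t -
  radial_partial a b r N t by move=> ->; ring.
rewrite /radial_ext; apply/cvg_lim => //; apply: cvg_trans c3; apply: near_eq_cvg.
near=> n; apply/esym/radial_partial_tail; near: n; exact: nbhs_infty_ge.
Unshelve. all: by end_near. Qed.

Lemma negligible_of_covers (S : set R) :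
  (forall e : R, 0 < e -> exists B, [/\ measurable B, (mu B <= e%:E)%E & S `<=` B]) ->
  mu.-negligible S.
Proof.
move=> H.
(* Intersect covers of measure at most 1/(n+1). *)
have /choice[B HB] n : exists B,
  [/\ measurable B, (mu B <= (n.+1%:R^-1)%:E)%E & S `<=` B].
  exact: H.
have mB n : measurable (B n) by have [] := HB n.
have mI : measurable (\bigcap_n B n) by apply: bigcap_measurable => //; exists 0%N.
exists (\bigcap_n B n); split => //; last first.
  by move=> t St n _; have [_ _] := HB n; apply.
apply/eqP; rewrite eq_le measure_ge0 andbT; apply/lee_addgt0Pr => e e0.
have [m me] := exists_invS_lt e0; rewrite add0e.
apply: (@le_trans _ _ (mu (B m))).
  by apply: le_measure; rewrite ?inE//; move=> t; apply.
by have [_ /le_trans + _] := HB m; apply; rewrite lee_fin ltW.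
Qed.

Lemma continuous_radial_partial_r a b N t : continuous (fun r =>
  radial_partial a b r N t).
Proof.
apply: continuous_bigsum => k; rewrite /trig_term /dilate => r.
have cX : (fun r : R => r ^+ k) @ r --> r ^+ k by exact: exprn_continuous.
by apply: cvgB; apply: cvgM; try exact: cvg_cst; apply: cvgM => //; exact: cvg_cst.
Qed.

(** Split the series into a polynomial, which is continuous up to the
    circle, and a tail of tiny energy.  Where the oscillation exceeds 3 la
    the tail must exceed la for some radius, and by
    [radial_ext_weak_type] this happens on a set as small as desired. *)
Lemma radial_cvg_ae a b A : energy_le a b A ->
  mu.-negligible (`[0, 2 * pi] `\` radial_cvg_set a b).
Proof.
move=> H.
have -> : `[0, 2 * pi] `\` radial_cvg_set a b =
   \bigcup_m (`[0, 2 * pi] `\` \bigcup_j oscillation_le a b m.+1%:R^-1 j.+1%:R^-1).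
  by rewrite /radial_cvg_set setDE setC_bigcap setI_bigcupr.
apply: negligible_bigcup => m; apply: negligible_of_covers => e e0.
pose la : R := m.+1%:R^-1 / 3.
have la0 : 0 < la by rewrite divr_gt0.
have pi0 := pi_gt0 R.
pose eta := e * la / (12 * pi).
have eta0 : 0 < eta by rewrite divr_gt0 ?mulr_gt0.
have [N /(_ N (leqnn N)) HN] := energy_le_tail H (exprn_gt0 2 eta0).
have [B [mB muB HB]] := radial_ext_weak_type la0 eta0 HN.
exists B; split => //.
  apply: le_trans muB _; rewrite lee_fin /eta [12 * pi * _]mulrC.
  by rewrite divfK ?mulfK// gt_eqF// mulr_gt0.
move=> t [/=]; rewrite in_itv/= => t02 nt; apply: contrapT => nB; apply: nt.
have := @continuous_radial_partial_r a b N t 1 => /cvgrPdist_le.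
have la2 : 0 < la / 2 by rewrite divr_gt0.
move=> /(_ _ la2)/nbhs_ballP[d /= d0 Hd].
have [j jd] := exists_invS_lt d0; exists j => // r s r01 s01 dr ds.
have near1 x : 0 <= x < 1 -> 1 - j.+1%:R^-1 <= x ->
   `|radial_partial a b 1 N t - radial_partial a b x N t| <= la / 2.
  move=> /andP[x0 x1] dx; apply: Hd => //=; rewrite /ball/= ger0_norm ?subr_ge0 ?ltW//.
  by apply: le_lt_trans jd; rewrite lerBlDr addrC -lerBlDr.
rewrite (radial_ext_tail t r01 H HN) (radial_ext_tail t s01 H HN).
have := HB t r t02 nB r01; have := HB t s t02 nB s01.
have := near1 r r01 dr; have := near1 s s01 ds.
have -> : m.+1%:R^-1 = 3 * la by rewrite /la mulrC divfK.
move: (radial_partial a b 1 N t) (radial_partial a b r N t) (radial_partial a b s N t)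
  (radial_ext _ _ r t) (radial_ext _ _ s t).
move=> p q u v w h1 h2 h3 h4.
have -> : q + v - (u + w) = (p - u) - (p - q) + (v - w) by ring.
rewrite (le_trans (ler_normD _ _))//.
have := ler_normB (p - u) (p - q); have := ler_normB v w; lra.
Qed.

End fatou.

(** * Energy of the boundary function *)

Section parseval.
Variable R : realType.
Set Implicit Arguments. Unset Strict Implicit.
Implicit Types (r s t x : R) (k N : nat) (a b : nat -> R) (u v : R -> R).
Local Notation mu := (@lebesgue_measure R).
Local Notation I := (`[0, 2 * pi]%classic : set R).

(** u + i v is almost everywhere the radial limit of the power series with
    coefficients a k + i b k. *)
Definition boundary_pair a b u v := [/\ measurable_fun [set: R] u,
  measurable_fun [set: R] v &
  {ae mu, forall t, I t -> (radial_ext a b r t @[r --> 1^'-] --> u t) /\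
                           (radial_ext b (opp_seq a) r t @[r --> 1^'-] --> v t)}].

Definition radius_seq m : R := 1 - m.+1%:R^-1.

Lemma radius_seq01 m : 0 <= radius_seq m < 1.
Proof.
by rewrite /radius_seq subr_ge0 invf_le1// ler1n/= ltrBlDr ltrDl invr_gt0.
Qed.

Lemma radius_seq_cvg : radius_seq m @[m --> \oo] --> 1^'-.
Proof.
move=> /= A [d /= d0 HA].
have := near_infty_natSinv_lt (PosNum d0); apply: filterS => m /= md.
apply: HA; last by have /andP[] := radius_seq01 m.
by rewrite /ball/= /radius_seq opprB addrC subrK ger0_norm// invr_ge0.
Qed.

Lemma measurable_EFinI (f : R -> R) : measurable_fun [set: R] f ->
  measurable_fun I (fun t => (f t)%:E).
Proof. by move=> mf; apply/measurable_EFinP; exact: measurable_funTS. Qed.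

Lemma limn_einf_le_cst (f : (\bar R)^nat) (c : \bar R) :
  (forall n, (f n <= c)%E) -> (limn_einf f <= c)%E.
Proof.
move=> H; rewrite limn_einf_lim; apply: lime_le; first exact: is_cvg_einfs.
apply: nearW => n; apply: le_trans (H n); apply: ereal_inf_lbound.
by exists n => /=.
Qed.

Lemma continuous_sqD (f g : R -> R) : continuous f -> continuous g ->
  continuous (fun x => f x ^+ 2 + g x ^+ 2).
Proof. by move=> cf cg x; apply: cvgD; exact: continuous_sqr. Qed.

Lemma pi2_gt0 : 0 < 2 * pi :> R. Proof. by rewrite mulr_gt0// pi_gt0. Qed.

Lemma parseval_02pi a b N :
  (\int[mu]_(t in I) (trig_poly a b N t ^+ 2 + trig_poly b (opp_seq a) N t ^+ 2)%:E =
  (2 * pi * \sum_(0 <= k < N) (a k ^+ 2 + b k ^+ 2))%:E)%E.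
Proof.
have := parseval_trig_poly a b N pi2_gt0; rewrite subr0 => <-; last first.
  by have := @whole_periods_2pi R 0 1; rewrite add0r mul1r.
rewrite /Rintegral fineK//; apply: integrable_fin_num => //.
by apply: continuous_integrable; apply: continuous_sqD; exact: continuous_trig_poly.
Qed.

Lemma energy_dilate_le a b A r N : 0 <= r < 1 -> energy_le a b A ->
  \sum_(0 <= k < N) (dilate r a k ^+ 2 + dilate r b k ^+ 2) <= A.
Proof.
move=> /andP[r0 r1] H; apply: le_trans (H N); apply: ler_sum => k _.
rewrite /dilate !exprMn -mulrDr -[leRHS]mul1r ler_wpM2r ?addr_ge0 ?sqr_ge0//.
by rewrite expr_le1// ?exprn_ge0// exprn_ile1// ltW.
Qed.

(** Along r_m -> 1 and truncation orders N_m chosen so that the truncation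
    error is at most 1/(m+1) uniformly in t, the truncated dilations converge
    to u + i v almost everywhere, while their energy is at most A by Parseval;
    conclude with Fatou's lemma. *)
Lemma boundary_energy_le a b u v A : boundary_pair a b u v -> energy_le a b A ->
  (\int[mu]_(t in I) (u t ^+ 2 + v t ^+ 2)%:E <= (2 * pi * A)%:E)%E.
Proof.
move=> [mu_ mv ae] H; have H' := energy_le_conj H.
have /choice[N HN] : forall m, exists N, forall a b t, energy_le a b A ->
    `|radial_ext a b (radius_seq m) t - radial_partial a b (radius_seq m) N t| <=
      m.+1%:R^-1.
  by move=> m; apply: radial_ext_approx => //; exact: radius_seq01.
pose f m t := (radial_partial a b (radius_seq m) (N m) t ^+ 2 +
  radial_partial b (opp_seq a) (radius_seq m) (N m) t ^+ 2)%:E.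
have cp a' b' m : continuous (radial_partial a' b' (radius_seq m) (N m))
  by exact: continuous_trig_poly.
have mf m : measurable_fun I (f m).
  apply: measurable_EFinI; apply: continuous_measurable_fun.
  by apply: continuous_sqD; exact: cp.
have f0 : forall m t, I t -> (0 <= f m t)%E.
  by move=> m t _; rewrite lee_fin addr_ge0 ?sqr_ge0.
have intf m : (\int[mu]_(t in I) f m t <= (2 * pi * A)%:E)%E.
  rewrite /f /radial_partial dilateN parseval_02pi lee_fin; apply: ler_wpM2l;
    first exact/ltW/pi2_gt0.
  by apply: energy_dilate_le => //; exact: radius_seq01.
apply: (@le_trans _ _ (\int[mu]_(t in I) limn_einf (f^~ t))%E); last first.
  have := @fatou _ _ _ mu I (measurable_itv _) f mf f0.
  by move=> /le_trans; apply; exact: limn_einf_le_cst.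
apply: ae_ge0_le_integral => //.
- by move=> t _; rewrite lee_fin addr_ge0 ?sqr_ge0.
- apply: measurable_EFinI.
  by apply: measurable_funD; apply: measurable_funX.
- move=> t It; rewrite limn_einf_lim; apply: lime_ge; first exact: is_cvg_einfs.
  by apply: nearW => n; apply: le_ereal_inf_tmp => _ [m _ <-]; exact: f0.
- apply: (emeasurable_fun_cvg (fun n t => einfs (f^~ t) n)).
    by move=> m; exact: measurable_fun_einfs.
  by move=> t _; rewrite limn_einf_lim; exact: is_cvg_einfs.
apply: (@filterS _ _ (ae_filter_ringOfSetsType mu)) ae => t Ht It; have [hu hv] :=
  Ht It.
have aux a' b' (w : R) : energy_le a' b' A -> radial_ext a' b' r t @[r --> 1^'-] -->
  w ->
    radial_partial a' b' (radius_seq m) (N m) t @[m --> \oo] --> w.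
  move=> Hs hw; have hw' := cvg_comp _ _ radius_seq_cvg hw.
  rewrite (_ : (fun m => radial_partial _ _ _ _ _) =
    (fun m => radial_ext a' b' (radius_seq m) t -
    (radial_ext a' b' (radius_seq m) t -
      radial_partial a' b' (radius_seq m) (N m) t))); last first.
    by apply/funext => m; ring.
  rewrite -[X in _ --> X](subr0 w); apply: cvgB; first exact: hw'.
  apply/cvgrPdist_le => e e0; have := near_infty_natSinv_lt (PosNum e0).
  apply: filterS => m me; rewrite sub0r normrN.
  by apply: le_trans (HN m a' b' t Hs) _; exact: ltW.
have cf : f m t @[m --> \oo] --> (u t ^+ 2 + v t ^+ 2)%:E.
  apply: cvg_EFin; first exact: nearW.
  rewrite (_ : fine \o _ =
    (fun m => radial_partial a b (radius_seq m) (N m) t * radial_partial a b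
    (radius_seq m) (N m) t
   + radial_partial b (opp_seq a) (radius_seq m) (N m) t * radial_partial b
     (opp_seq a) (radius_seq m) (N m) t)); last first.
    by apply/funext => m /=; rewrite !expr2.
  by rewrite !expr2; apply: cvgD; apply: cvgM; exact: aux.
by rewrite is_cvg_limn_einfE; [rewrite (cvg_lim _ cf)|exact: cvgP cf].
Qed.

Lemma dilate1 a : dilate 1 a = a.
Proof. by apply/funext => k; rewrite /dilate expr1n mul1r. Qed.

Lemma radial_partial_cvg1 a b N t : radial_partial a b r N t @[r --> 1^'-] -->
  trig_poly a b N t.
Proof.
have := cvg_at_left_filter (@continuous_radial_partial_r R a b N t 1).
by rewrite {2}/radial_partial !dilate1.
Qed.

Lemma boundary_pair_tail a b u v A B N : energy_le a b A ->
  energy_le (seq_tail N a) (seq_tail N b) B ->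
  boundary_pair a b u v ->
  boundary_pair (seq_tail N a) (seq_tail N b) (fun t => u t - trig_poly a b N t)
     (fun t => v t - trig_poly b (opp_seq a) N t).
Proof.
move=> H HB [mu_ mv ae]; split.
- apply: measurable_funB => //; apply: continuous_measurable_fun;
  exact: continuous_trig_poly.
- apply: measurable_funB => //; apply: continuous_measurable_fun;
  exact: continuous_trig_poly.
have HS := energy_le_conj H; have HBS := energy_le_conj HB.
have tN : seq_tail N (opp_seq a) = opp_seq (seq_tail N a).
  by apply/funext => k; rewrite /seq_tail /opp_seq; case: ifP => //; rewrite oppr0.
have aux a' b' (w : R) t : energy_le a' b' A ->
  energy_le (seq_tail N a') (seq_tail N b') B ->
   radial_ext a' b' r t @[r --> 1^'-] --> w ->
   radial_ext (seq_tail N a') (seq_tail N b') r t @[r --> 1^'-] -->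
     w - trig_poly a' b' N t.
  move=> h1 h2 hw; have hh : radial_ext a' b' r t -
    radial_partial a' b' r N t @[r --> 1^'-] --> w - trig_poly a' b' N t.
    by apply: cvgB => //; exact: radial_partial_cvg1.
  apply: (cvg_trans _ hh); apply: near_eq_cvg; near=> r.
  have r01 : 0 <= r < 1.
    apply/andP; split; near: r; last exact: nbhs_left_lt.
    exact: nbhs_left_ge.
  by rewrite /= (radial_ext_tail t r01 h1 h2); ring.
apply: (@filterS _ _ (ae_filter_ringOfSetsType mu)) ae => t Ht It; have [hu hv] :=
  Ht It; split; first exact: aux.
by rewrite -tN; apply: aux => //; rewrite tN.
Unshelve. all: by end_near. Qed.

Definition energy_cvg a b S :=
  (fun N => \sum_(0 <= k < N) (a k ^+ 2 + b k ^+ 2)) @ \oo --> (S : R).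

Lemma energy_cvg_le a b S : energy_cvg a b S -> energy_le a b S.
Proof.
move=> H N; rewrite -(cvg_lim _ H)//; apply: nondecreasing_cvgn_le; last exact: cvgP H.
move=> m n mn; rewrite (@big_cat_nat _ _ _ m 0 n)//= lerDl sumr_ge0// => i _.
by rewrite addr_ge0 ?sqr_ge0.
Qed.

(** The upper bound is [boundary_energy_le].  For the lower bound apply it
    to the tail after a polynomial p: the boundary function is then within a
    small L^2 distance of p, whose energy is known exactly.  The triangle
    inequality is used in the form
    p^2 <= (1 + e) u^2 + (1 + 1/e) (u - p)^2. *)
Lemma boundary_energyE a b u v S : boundary_pair a b u v -> energy_cvg a b S ->
  (\int[mu]_(t in I) (u t ^+ 2 + v t ^+ 2)%:E = (2 * pi * S)%:E)%E.
Proof.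
move=> bp cS; have HS := energy_cvg_le cS.
have Xle := boundary_energy_le bp HS; have pi0 := pi_gt0 R.
have X0 : (0 <= \int[mu]_(t in I) (u t ^+ 2 + v t ^+ 2)%:E)%E.
  by apply: integral_ge0 => t _; rewrite lee_fin addr_ge0 ?sqr_ge0.
have [X XE] : exists X : R, (\int[mu]_(t in I) (u t ^+ 2 + v t ^+ 2)%:E = X%:E)%E.
  exists (fine (\int[mu]_(t in I) (u t ^+ 2 + v t ^+ 2)%:E)%E); rewrite fineK//.
  by rewrite ge0_fin_numE// (le_lt_trans Xle)// ltry.
move: Xle X0; rewrite XE !lee_fin => Xle X0; congr EFin; apply/eqP.
rewrite eq_le Xle/=.
have S0 : 0 <= S by apply: le_trans (HS 0%N); rewrite big_nil.
have key e : 0 < e <= 1 -> 2 * pi * (S - e ^+ 2) <=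
  (1 + e) * X + (1 + e^-1) * (2 * pi * e ^+ 2).
  move=> /andP[e0 e1]; have e20 : 0 < e ^+ 2 by rewrite exprn_gt0.
  have [N0 HN0] := energy_le_tail HS e20.
  have [N1 _ HN1] : \forall n \near \oo,
    S - \sum_(0 <= k < n) (a k ^+ 2 + b k ^+ 2) <= e ^+ 2.
    have /cvgrPdist_le/(_ _ e20) := cS; apply: filterS => n.
    by apply: le_trans; exact: ler_norm.
  pose N := maxn N0 N1.
  have HT := HN0 N (leq_maxl _ _); have HSN := HN1 N (leq_maxr _ _).
  have [mu_ mv _] := bp.
  have bt := boundary_pair_tail HS HT bp; have tle := boundary_energy_le bt HT.
  have [mut mvt _] := bt.
  have e11 : 0 <= 1 + e by rewrite addr_ge0// ltW.
  have e10 : 0 <= 1 + e^-1 by rewrite addr_ge0// invr_ge0 ltW.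
  rewrite -lee_fin.
  apply: (@le_trans _ _ (2 * pi * \sum_(0 <= k < N) (a k ^+ 2 + b k ^+ 2))%:E).
    rewrite lee_fin; apply: ler_wpM2l; first exact/ltW/pi2_gt0.
    by move: HSN => /=; lra.
  rewrite -parseval_02pi.
  apply: (@le_trans _ _ (\int[mu]_(t in I) ((1 + e)%:E * (u t ^+ 2 + v t ^+ 2)%:E +
    (1 + e^-1)%:E * ((u t - trig_poly a b N t) ^+ 2 +
      (v t - trig_poly b (opp_seq a) N t) ^+ 2)%:E))%E).
    apply: ge0_le_integral => //.
    - by move=> t _; rewrite lee_fin addr_ge0 ?sqr_ge0.
    - apply: measurable_EFinI; apply: continuous_measurable_fun.
      by apply: continuous_sqD; exact: continuous_trig_poly.
    - apply: measurable_EFinI; apply: measurable_funD.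
        by apply: measurable_funM => //; apply: measurable_funD; apply: measurable_funX.
      by apply: measurable_funM => //; apply: measurable_funD; apply: measurable_funX.
    move=> t _; rewrite -!EFinM -EFinD lee_fin.
    have aux (p w : R) : p ^+ 2 <= (1 + e) * w ^+ 2 + (1 + e^-1) * (w - p) ^+ 2.
      have en0 : e != 0 by rewrite gt_eqF.
      have E : (1 + e) * w ^+ 2 + (1 + e^-1) * (w - p) ^+ 2 - p ^+ 2 =
         e * (w + e^-1 * (w - p)) ^+ 2 by field.
      by rewrite -subr_ge0 E mulr_ge0 ?sqr_ge0// ltW.
    rewrite !mulrDr addrACA; apply: lerD; exact: aux.
  rewrite ge0_integralD//; last 4 first.
  - by move=> t _; rewrite -EFinM lee_fin; apply: mulr_ge0 => //; apply: addr_ge0;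
    exact: sqr_ge0.
  - apply: measurable_EFinI.
    by apply: measurable_funM => //; apply: measurable_funD; apply: measurable_funX.
  - by move=> t _; rewrite -EFinM lee_fin; apply: mulr_ge0 => //; apply: addr_ge0;
    exact: sqr_ge0.
  - apply: measurable_EFinI.
    by apply: measurable_funM => //; apply: measurable_funD; apply: measurable_funX.
  rewrite !ge0_integralZl//; last 4 first.
  - apply: measurable_EFinI.
    by apply: measurable_funD; apply: measurable_funX.
  - by move=> t _; rewrite lee_fin addr_ge0 ?sqr_ge0.
  - apply: measurable_EFinI.
    by apply: measurable_funD; apply: measurable_funX.
  - by move=> t _; rewrite lee_fin addr_ge0 ?sqr_ge0.
  rewrite XE !EFinD !EFinM -!EFinM; apply: leeD => //.
  by rewrite EFinM; apply: lee_wpmul2l => //; rewrite lee_fin.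
rewrite leNgt; apply/negP => lt.
(* If X were smaller, e = (2 pi S - X) / (2 (X + 6 pi)) would contradict key. *)
pose D := X + 6 * pi.
have D0 : 0 < D by rewrite /D; lra.
(* The cap at 1 keeps e^2 <= e. *)
pose e := Num.min 1 ((2 * pi * S - X) / (2 * D)).
have g0 : 0 < (2 * pi * S - X) / (2 * D) by rewrite divr_gt0 ?subr_gt0 ?mulr_gt0.
have e0 : 0 < e by rewrite /e lt_min ltr01.
have e1 : e <= 1 by rewrite /e ge_min lexx.
have eD : e * (2 * D) <= 2 * pi * S - X.
  by rewrite -ler_pdivlMr ?mulr_gt0// /e ge_min lexx orbT.
have := key e; rewrite e0 e1 => /(_ isT).
have -> : (1 + e^-1) * (2 * pi * e ^+ 2) = 2 * pi * (e ^+ 2 + e) by field;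
  rewrite gt_eqF.
have e2 : 2 * pi * e ^+ 2 <= 2 * pi * e.
  by rewrite ler_pM2l ?pi2_gt0// expr2 ger_pMr.
move: eD; rewrite /D => eD kk.
have : e * pi > 0 by rewrite mulr_gt0.
have : 0 <= e * X by rewrite mulr_ge0// ltW.
lra.
Qed.

End parseval.

(** * Inner products of boundary functions *)

Section polarization.
Variable R : realType.
Set Implicit Arguments. Unset Strict Implicit.
Implicit Types (r s t x : R) (k N : nat) (a b : nat -> R) (u v : R -> R).
Local Notation mu := (@lebesgue_measure R).
Local Notation I := (`[0, 2 * pi]%classic : set R).

Lemma radial_ext_lin a b a' b' A A' (c : R) r t : 0 <= r < 1 -> energy_le a b A ->
  energy_le a' b' A' ->
  radial_ext (fun k => a k + c * a' k) (fun k => b k + c * b' k) r t =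
  radial_ext a b r t + c * radial_ext a' b' r t.
Proof.
move=> r01 H H'; apply/cvg_lim => //.
have cv := @radial_partial_cvg R a b A r t r01 H; have cv' :=
  @radial_partial_cvg R a' b' A' r t r01 H'.
rewrite (_ : (fun N => _) =
  (fun N => radial_partial a b r N t + c * radial_partial a' b' r N t)).
  by apply: cvgD => //; apply: cvgM => //; exact: cvg_cst.
apply/funext => N; rewrite /radial_partial /trig_poly big_distrr/= -big_split/=.
by apply: eq_bigr => k _; rewrite /trig_term /dilate; ring.
Qed.

Lemma near_left1 (P : R -> Prop) : (forall r, 0 <= r < 1 -> P r) ->
  \forall r \near 1^'-, P r.
Proof.
move=> H; near=> r; apply: H; apply/andP; split; near: r; last exact: nbhs_left_lt.
exact: nbhs_left_ge.
Unshelve. all: by end_near. Qed.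

Lemma boundary_pair_lin a b a' b' u v u' v' A A' (c : R) : energy_le a b A ->
  energy_le a' b' A' ->
  boundary_pair a b u v -> boundary_pair a' b' u' v' ->
  boundary_pair (fun k => a k + c * a' k) (fun k => b k + c * b' k)
    (fun t => u t + c * u' t) (fun t => v t + c * v' t).
Proof.
move=> H H' [mu1 mv1 ae1] [mu2 mv2 ae2]; split.
- by apply: measurable_funD => //; apply: measurable_funM.
- by apply: measurable_funD => //; apply: measurable_funM.
have HS := energy_le_conj H; have HS' := energy_le_conj H'.
have aux p q p' q' (w w' : R) t : energy_le p q A -> energy_le p' q' A' ->
  radial_ext p q r t @[r --> 1^'-] --> w -> radial_ext p' q' r t @[r --> 1^'-] --> w' ->
  radial_ext (fun k => p k + c * p' k) (fun k => q k + c * q' k) r t @[r --> 1^'-] -->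
    w + c * w'.
  move=> h1 h2 hw hw'.
  have hh : radial_ext p q r t + c * radial_ext p' q' r t @[r --> 1^'-] --> w + c * w'.
    by apply: cvgD => //; apply: cvgM => //; exact: cvg_cst.
  apply: (cvg_trans _ hh); apply: near_eq_cvg; apply: near_left1 => r r01.
  by rewrite (radial_ext_lin c t r01 h1 h2).
have nE : opp_seq (fun k => a k + c * a' k) = (fun k => opp_seq a k + c * opp_seq a' k).
  by apply/funext => k; rewrite /opp_seq; ring.
apply: (@filterS2 _ _ (ae_filter_ringOfSetsType mu)) ae1 ae2 => t H1 H2 It.
have [u1 v1] := H1 It; have [u2 v2] := H2 It; split; first exact: aux.
by rewrite nE; apply: aux.
Qed.

(** Multiplication of the power series by - i. *)
Lemma boundary_pair_rot a b u v A : energy_le a b A -> boundary_pair a b u v ->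
  boundary_pair b (opp_seq a) v (fun t => - u t).
Proof.
move=> H [mu1 mv1 ae1]; split => //; first exact: measurableT_comp.
apply: (@filterS _ _ (ae_filter_ringOfSetsType mu)) ae1 => t H1 It.
have [u1 v1] := H1 It; split => //.
have hh : - radial_ext a b r t @[r --> 1^'-] --> - u t by exact: cvgN.
apply: (cvg_trans _ hh); apply: near_eq_cvg; apply: near_left1 => r r01.
apply/esym/cvg_lim => //.
rewrite (_ : (fun N => _) = (fun N => - radial_partial a b r N t)).
  by apply: cvgN; exact: (@radial_partial_cvg R a b A).
by apply/funext => N; rewrite /radial_partial !dilateN trig_polyN.
Qed.

Lemma measurable_sqD u v : measurable_fun [set: R] u -> measurable_fun [set: R] v ->
  measurable_fun [set: R] (fun t => u t ^+ 2 + v t ^+ 2).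
Proof. by move=> m1 m2; apply: measurable_funD; apply: measurable_funX. Qed.

Lemma boundary_energyR a b u v S : boundary_pair a b u v -> energy_cvg a b S ->
  mu.-integrable I (EFin \o (fun t => u t ^+ 2 + v t ^+ 2)) /\
  \int[mu]_(t in I) (u t ^+ 2 + v t ^+ 2) = 2 * pi * S.
Proof.
move=> bp cS; have E := boundary_energyE bp cS; split; last by rewrite /Rintegral E.
have [m1 m2 _] := bp; apply/integrableP; split.
  by apply: measurable_EFinI; exact: measurable_sqD.
rewrite [X in (X < _)%E](_ : _ = (2 * pi * S)%:E) ?ltry// -E.
apply: eq_integral => t _; by rewrite /= ger0_norm// addr_ge0 ?sqr_ge0.
Qed.

(** Polarisation of the energy identity. *)
Lemma boundary_inner a b a' b' u v u' v' S S' T :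
  energy_cvg a b S -> energy_cvg a' b' S' ->
  (fun N => \sum_(0 <= k < N) (a k * a' k + b k * b' k)) @ \oo --> (T : R) ->
  boundary_pair a b u v -> boundary_pair a' b' u' v' ->
  \int[mu]_(t in I) (u t * u' t + v t * v' t) = 2 * pi * T.
Proof.
move=> cS cS' cT bp bp'; have H := energy_cvg_le cS; have H' := energy_cvg_le cS'.
have lin c : energy_cvg (fun k => a k + c * a' k) (fun k => b k + c * b' k)
    (S + c ^+ 2 * S' + 2 * c * T).
  rewrite /energy_cvg (_ : (fun N => _) =
    (fun N => \sum_(0 <= k < N) (a k ^+ 2 + b k ^+ 2) +
     c ^+ 2 * \sum_(0 <= k < N) (a' k ^+ 2 + b' k ^+ 2) +
     2 * c * \sum_(0 <= k < N) (a k * a' k + b k * b' k))).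
    apply: cvgD; first apply: cvgD => //; apply: cvgM => //; exact: cvg_cst.
  apply/funext => N; rewrite !big_distrr/= -!big_split/=.
  by apply: eq_bigr => k _; ring.
have [i1 e1] := boundary_energyR (boundary_pair_lin 1 H H' bp bp') (lin 1).
have [i2 e2] := boundary_energyR (boundary_pair_lin (-1) H H' bp bp') (lin (-1)).
transitivity (\int[mu]_(t in I) (4^-1 * ((u t + 1 * u' t) ^+ 2 + (v t + 1 * v' t) ^+ 2)
    - 4^-1 * ((u t + -1 * u' t) ^+ 2 + (v t + -1 * v' t) ^+ 2))).
  by apply: eq_Rintegral => t _; field.
rewrite RintegralB//; last 2 first.
- exact: (@integrableZl _ _ R mu I (measurable_itv _) 4^-1 _ i1).
- exact: (@integrableZl _ _ R mu I (measurable_itv _) 4^-1 _ i2).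
by rewrite !RintegralZl// e1 e2; field.
Qed.

End polarization.

(** * From complex power series to real boundary functions *)

Section complex_series.
Variable R : realType.
Set Implicit Arguments. Unset Strict Implicit.
Local Notation C := R[i].
Local Notation mu := (@lebesgue_measure R).
Local Notation I := (`[0, 2 * pi]%classic : set R).

Lemma cmodE (z : C) : cmod z = Num.sqrt (complex.Re z ^+ 2 + complex.Im z ^+ 2).
Proof. by rewrite /cmod; case: z. Qed.

Lemma cmod_sqr (z : C) : cmod z ^+ 2 = complex.Re z ^+ 2 + complex.Im z ^+ 2.
Proof. by rewrite cmodE sqr_sqrtr// addr_ge0 ?sqr_ge0. Qed.

Lemma norm_cmod (z : C) : `|z| = (cmod z)%:C.
Proof. by rewrite /cmod; case: z. Qed.

Lemma cmod_ge0 (z : C) : 0 <= cmod z.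
Proof. by rewrite cmodE sqrtr_ge0. Qed.

Lemma cmodM (z w : C) : cmod (z * w) = cmod z * cmod w.
Proof. by apply: (@complexI R); rewrite rmorphM/= -!norm_cmod normrM. Qed.

Lemma cmodD (z w : C) : cmod (z + w) <= cmod z + cmod w.
Proof. by rewrite -lecR rmorphD/= -!norm_cmod ler_normD. Qed.

Lemma cmodN (z : C) : cmod (- z) = cmod z.
Proof. by apply: (@complexI R); rewrite -!norm_cmod normrN. Qed.

Lemma cmod_real (x : R) : cmod x%:C = `|x|.
Proof. by rewrite cmodE/= expr0n/= addr0 sqrtr_sqr. Qed.

Lemma Re_le_cmod (z : C) : `|complex.Re z| <= cmod z.
Proof.
by rewrite cmodE -[leLHS]sqrtr_sqr ler_sqrt ?lerDl ?addr_ge0 ?sqr_ge0.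
Qed.

Lemma Im_le_cmod (z : C) : `|complex.Im z| <= cmod z.
Proof.
by rewrite cmodE -[leLHS]sqrtr_sqr ler_sqrt ?lerDr ?addr_ge0 ?sqr_ge0.
Qed.

Lemma cmod_le_ReIm (z : C) : cmod z <= `|complex.Re z| + `|complex.Im z|.
Proof.
case: z => a b; rewrite (_ : a +i* b = a%:C + 'i * b%:C); last first.
  by rewrite [LHS]complexE.
apply: le_trans (cmodD _ _) _; rewrite cmodM !cmod_real/= !mul0r !mul1r.
rewrite (_ : cmod 'i = 1) ?mul1r; last by rewrite cmodE/= expr0n/= add0r expr1n sqrtr1.
by rewrite lerD// ?subr0 ?addr0 ?add0r.
Qed.

Section cvg.
Context {T : Type} (F : set_system T) {FF : Filter F}.

Lemma cvgC_cmod (u : T -> C) (l : C) :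
  ((fun x => u x : R[i]^o) @ F --> (l : R[i]^o)) <->
  (forall e : R, 0 < e -> \forall x \near F, cmod (l - u x) < e).
Proof.
split=> [/cvgrPdist_lt H e e0|H].
  have e0' : 0 < e%:C :> R[i]^o by rewrite ltcR.
  by have := H _ e0'; apply: filterS => x; rewrite norm_cmod ltcR.
apply/cvgrPdist_lt => -[e i]; rewrite ltcE/= => /andP[/eqP -> e0].
by have := H e e0; apply: filterS => x; rewrite norm_cmod -ltcR.
Qed.

Lemma cvgCP (u : T -> C) (l : C) :
  ((fun x => u x : R[i]^o) @ F --> (l : R[i]^o)) <->
  (complex.Re (u x) @[x --> F] --> complex.Re l /\
   complex.Im (u x) @[x --> F] --> complex.Im l).
Proof.
split=> [/cvgC_cmod H|[HR HI]].
  split; apply/cvgrPdist_lt => e e0; have := H e e0; apply: filterS => x;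
    apply: le_lt_trans.
    by rewrite (le_trans _ (Re_le_cmod _)) //; case: (l) (u x) => ? ? [].
  by rewrite (le_trans _ (Im_le_cmod _)) //; case: (l) (u x) => ? ? [].
apply/cvgC_cmod => e e0; have e2 : 0 < e / 2 by rewrite divr_gt0.
have /cvgrPdist_lt/(_ _ e2) H1 := HR; have /cvgrPdist_lt/(_ _ e2) H2 := HI.
apply: filterS2 H1 H2 => x h1 h2; apply: le_lt_trans (cmod_le_ReIm _) _.
rewrite (splitr e) ltrD//; first by move: h1; case: (l) (u x) => ? ? [].
by move: h2; case: (l) (u x) => ? ? [].
Qed.

Lemma cvgC_D (u v : T -> C) (l m : C) :
  ((fun x => u x : R[i]^o) @ F --> (l : R[i]^o)) ->
  ((fun x => v x : R[i]^o) @ F --> (m : R[i]^o)) ->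
  ((fun x => u x + v x : R[i]^o) @ F --> (l + m : R[i]^o)).
Proof.
move=> /cvgCP[u1 u2] /cvgCP[v1 v2]; apply/cvgCP; split.
  rewrite (_ : (fun x => _) = (fun x => complex.Re (u x) + complex.Re (v x))).
    by rewrite (_ : complex.Re _ = complex.Re l + complex.Re m);
      [exact: cvgD|case: (l) (m) => ? ? []].
  by apply/funext => x; case: (u x) (v x) => ? ? [].
rewrite (_ : (fun x => _) = (fun x => complex.Im (u x) + complex.Im (v x))).
  by rewrite (_ : complex.Im _ = complex.Im l + complex.Im m);
    [exact: cvgD|case: (l) (m) => ? ? []].
by apply/funext => x; case: (u x) (v x) => ? ? [].
Qed.

Lemma cvgC_M (u v : T -> C) (l m : C) :
  ((fun x => u x : R[i]^o) @ F --> (l : R[i]^o)) ->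
  ((fun x => v x : R[i]^o) @ F --> (m : R[i]^o)) ->
  ((fun x => u x * v x : R[i]^o) @ F --> (l * m : R[i]^o)).
Proof.
move=> /cvgCP[u1 u2] /cvgCP[v1 v2]; apply/cvgCP; split.
  rewrite (_ : (fun x => _) = (fun x => complex.Re (u x) * complex.Re (v x) -
    complex.Im (u x) * complex.Im (v x))).
    rewrite (_ : complex.Re _ = complex.Re l * complex.Re m -
      complex.Im l * complex.Im m).
      by apply: cvgB; apply: cvgM.
    by case: (l) (m) => ? ? [].
  by apply/funext => x; case: (u x) (v x) => ? ? [].
rewrite (_ : (fun x => _) = (fun x => complex.Re (u x) * complex.Im (v x) +
    complex.Im (u x) * complex.Re (v x))).
  rewrite (_ : complex.Im _ = complex.Re l * complex.Im m +
    complex.Im l * complex.Re m).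
    by apply: cvgD; apply: cvgM.
  by case: (l) (m) => ? ? [].
by apply/funext => x; case: (u x) (v x) => ? ? [].
Qed.

Lemma cvgC_conj (u : T -> C) (l : C) :
  ((fun x => u x : R[i]^o) @ F --> (l : R[i]^o)) ->
  ((fun x => (u x)^* : R[i]^o) @ F --> (l^* : R[i]^o)).
Proof.
move=> /cvgCP[u1 u2]; apply/cvgCP; split.
  rewrite (_ : (fun x => _) = (fun x => complex.Re (u x))).
    by rewrite (_ : complex.Re _ = complex.Re l) //; case: (l).
  by apply/funext => x; case: (u x).
rewrite (_ : (fun x => _) = (fun x => - complex.Im (u x))).
  by rewrite (_ : complex.Im _ = - complex.Im l); [exact: cvgN|case: (l)].
by apply/funext => x; case: (u x).
Qed.

Lemma cvgC_cst (l : C) : ((fun x => l : R[i]^o) @ F --> (l : R[i]^o)).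
Proof. by apply/cvgCP; split; exact: cvg_cst. Qed.

Lemma cvgC_ext (u v : T -> C) (l m : C) :
  ((fun x => u x : R[i]^o) @ F --> (l : R[i]^o)) -> u =1 v -> l = m ->
  ((fun x => v x : R[i]^o) @ F --> (m : R[i]^o)).
Proof. by move=> + /funext <- <-. Qed.

End cvg.

Definition re_coef (c : nat -> C) k : R := complex.Re (c k).
Definition im_coef (c : nat -> C) k : R := complex.Im (c k).
Definition polar (r t : R) : C := r%:C * (cos t +i* sin t).

Lemma polarX r t k : polar r t ^+ k = (r ^+ k)%:C * (cos (k%:R * t) +i* sin (k%:R * t)).
Proof.
rewrite /polar exprMn rmorphXn/=; congr (_ * _); elim: k => [|k IH].
  by rewrite expr0 mul0r cos0 sin0.
rewrite exprS IH -natr1 mulrDl mul1r cosD sinD.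
by apply/eqP; rewrite eq_complex /=; apply/andP; split; apply/eqP; ring.
Qed.

Lemma cmod_polar r t : 0 <= r -> cmod (polar r t) = r.
Proof.
move=> r0; rewrite cmodM cmod_real ger0_norm// cmodE/= cos2Dsin2 sqrtr1 mulr1.
by [].
Qed.

Lemma Re_term c k r t :
  complex.Re (c k * polar r t ^+ k) =
    trig_term (dilate r (re_coef c)) (dilate r (im_coef c)) k t.
Proof.
by rewrite polarX /trig_term /dilate /re_coef /im_coef; case: (c k) => x y /=; ring.
Qed.

Lemma Im_term c k r t :
  complex.Im (c k * polar r t ^+ k) =
  trig_term (dilate r (im_coef c)) (dilate r (opp_seq (re_coef c))) k t.
Proof.
by rewrite polarX /trig_term /dilate /opp_seq /re_coef /im_coef; case: (c k) =>
  x y /=; ring.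
Qed.

Lemma Re_sum (c : nat -> C) N : complex.Re (\sum_(0 <= k < N) c k) =
  \sum_(0 <= k < N) complex.Re (c k).
Proof.
elim: N => [|N IH]; first by rewrite !big_nil.
by rewrite !big_nat_recr//= -IH; case: (\sum_(0 <= _ < _) _) (c N) => ? ? [].
Qed.

Lemma Im_sum (c : nat -> C) N : complex.Im (\sum_(0 <= k < N) c k) =
  \sum_(0 <= k < N) complex.Im (c k).
Proof.
elim: N => [|N IH]; first by rewrite !big_nil.
by rewrite !big_nat_recr//= -IH; case: (\sum_(0 <= _ < _) _) (c N) => ? ? [].
Qed.

Lemma taylor_polar f c r t : taylor_expansion f c -> 0 <= r < 1 ->
  f (polar r t) = radial_ext (re_coef c) (im_coef c) r t +i* radial_ext (im_coef c)
    (opp_seq (re_coef c)) r t.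
Proof.
move=> fc /andP[r0 r1]; have D : unit_disc (polar r t).
  by rewrite /unit_disc/= cmod_polar.
have /cvgCP[cR cI] := fc _ D.
have ER : complex.Re (f (polar r t)) = radial_ext (re_coef c) (im_coef c) r t.
  apply/esym/cvg_lim => //; apply: cvg_trans cR; apply: near_eq_cvg; apply: nearW => N.
  by rewrite /series/= Re_sum; apply: eq_bigr => k _; rewrite Re_term.
have EI : complex.Im (f (polar r t)) = radial_ext (im_coef c) (opp_seq (re_coef c)) r t.
  apply/esym/cvg_lim => //; apply: cvg_trans cI; apply: near_eq_cvg; apply: nearW => N.
  by rewrite /series/= Im_sum; apply: eq_bigr => k _; rewrite Im_term.
by rewrite -ER -EI; case: (f _).
Qed.

Definition radial_limit (a b : nat -> R) (t : R) : R :=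
  lim (radial_ext a b r t @[r --> 1^'-]).

(** Off the set of radial convergence the limit operator returns a fixed
    default value, so the boundary value is measurable as soon as that set
    is. *)
Lemma boundary_valueE f c t : taylor_expansion f c ->
  boundary_value f t =
  if t \in radial_cvg_set (re_coef c) (im_coef c) `&` radial_cvg_set (im_coef c)
    (opp_seq (re_coef c))
  then radial_limit (re_coef c) (im_coef c) t +i* radial_limit (im_coef c)
    (opp_seq (re_coef c)) t
  else (point : R[i]^o).
Proof.
move=> fc; set a := re_coef c; set b := im_coef c.
pose g r : C := radial_ext a b r t +i* radial_ext b (opp_seq a) r t.
have near_g : \forall r \near 1^'-, (f (r%:C * (cos t +i* sin t)) : R[i]^o) = g r.
  by apply: near_left1 => r r01; exact: (taylor_polar t fc r01).
have EQ : forall l : C, ((f (r%:C * (cos t +i* sin t)) : R[i]^o) @[r --> (1:R)^'-] -->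
  (l : R[i]^o)) <->
   ((g r : R[i]^o) @[r --> (1:R)^'-] --> (l : R[i]^o)).
  move=> l; split; apply: cvg_trans; apply: near_eq_cvg.
    exact: near_g.
  by apply: filterS near_g => r ->.
rewrite /boundary_value; case: ifPn =>
  [/set_mem[/radial_cvg_setP h1 /radial_cvg_setP h2]|nD].
  have hc := (EQ (radial_limit a b t +i* radial_limit b (opp_seq a) t)).2.
  have := @cvg_lim R[i]^o (@norm_hausdorff _ R[i]^o) _ _ _ _ _ (hc _); apply.
  by apply/cvgCP.
apply: (@dvgP R[i]^o) => /cvg_ex[l /EQ/cvgCP[h1 h2]].
by move/negP: nD; apply; apply/mem_set; split; apply/radial_cvg_setP; apply: cvgP;
  [exact: h1|exact: h2].
Qed.

Definition square_summable (c : nat -> C) := cvgn (series (fun k => cmod (c k) ^+ 2)).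

Lemma square_summable_energy_cvg c : square_summable c ->
  energy_cvg (re_coef c) (im_coef c) (limn (series (fun k => cmod (c k) ^+ 2))).
Proof.
move=> H; rewrite /energy_cvg; apply: cvg_trans H; apply: near_eq_cvg; apply: nearW =>
  N.
by rewrite /series/=; apply: eq_bigr => k _; rewrite cmod_sqr.
Qed.

Lemma measurable_radial_limit (a b : nat ->
  R) (A : R) (D : set R) : energy_le a b A -> measurable D -> D `<=`
  radial_cvg_set a b ->
  measurable_fun D (radial_limit a b).
Proof.
move=> H mD DC; apply: (@measurable_fun_cvg _ _ _ _ (fun m =>
  radial_ext a b (radius_seq R m))).
  move=> m; apply: measurable_funS (continuous_measurable_fun _) => //.
  by apply: (@continuous_radial_ext R a b A) => //; exact: radius_seq01.
move=> t Dt; have /radial_cvg_setP hc : radial_cvg_set a b t by exact: DC.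
exact: (cvg_comp _ _ (@radius_seq_cvg R) hc).
Qed.

Lemma boundary_pair_boundary_value f c : taylor_expansion f c -> square_summable c ->
  boundary_pair (re_coef c) (im_coef c) (fun t => complex.Re (boundary_value f t))
    (fun t => complex.Im (boundary_value f t)).
Proof.
move=> fc sc; have H := energy_cvg_le (square_summable_energy_cvg sc); have H' :=
  energy_le_conj H.
set a := re_coef c in H H' *; set b := im_coef c in H H' *.
pose D := radial_cvg_set a b `&` radial_cvg_set b (opp_seq a).
have mD : measurable D by apply: measurableI; exact: measurable_radial_cvg_set.
have mDC : measurable (~` D) by exact: measurableC.
have BE t := @boundary_valueE f c t fc.
have inD t : D t -> t \in radial_cvg_set a b `&` radial_cvg_set b (opp_seq a)
  by move=> Dt; rewrite inE.
have ninD t : (~` D) t ->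
  (t \in radial_cvg_set a b `&` radial_cvg_set b (opp_seq a)) = false.
  by move=> Dt; apply/negbTE; rewrite notin_setE.
have UD : [set: R] = D `|` ~` D by rewrite setUCr.
have piece (p : C -> R) : measurable_fun D (fun t => p (boundary_value f t)) ->
    measurable_fun [set: R] (fun t => p (boundary_value f t)).
  move=> mp; rewrite UD; apply/measurable_funU => //; split => //.
  apply: (eq_measurable_fun (cst (p (point : R[i]^o)))) => // t; rewrite inE => Dt.
  by rewrite BE ninD.
split.
- apply: piece.
  apply: (eq_measurable_fun (radial_limit a b)).
    by move=> t; rewrite inE => Dt; rewrite BE inD.
  by apply: (measurable_radial_limit H) => // t [].
- apply: piece.
  apply: (eq_measurable_fun (radial_limit b (opp_seq a))).
    by move=> t; rewrite inE => Dt; rewrite BE inD.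
  by apply: (measurable_radial_limit H') => // t [].
have := negligibleU (radial_cvg_ae H) (radial_cvg_ae H').
apply: negligibleS => t /= nt; apply: contrapT => /not_orP[n1 n2]; apply: nt => It.
have c1 : radial_cvg_set a b t by apply: contrapT => nc; apply: n1.
have c2 : radial_cvg_set b (opp_seq a) t by apply: contrapT => nc; apply: n2.
have Dt : D t by split.
by rewrite BE inD//=; split; apply/radial_cvg_setP.
Qed.

(** The real part is [boundary_inner] for the two functions, the imaginary part
    is [boundary_inner] after multiplying f by - i. *)
Lemma hardy_innerE f g c d T1 T2 : taylor_expansion f c -> taylor_expansion g d ->
  square_summable c -> square_summable d ->
  (fun N => \sum_(0 <= k < N) (re_coef c k * re_coef d k + im_coef c k * im_coef d k))
    @ \oo --> (T1 : R) ->
  (fun N => \sum_(0 <= k < N) (im_coef c k * re_coef d k - re_coef c k * im_coef d k))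
    @ \oo --> (T2 : R) ->
  hardy_inner f g = T1 +i* T2.
Proof.
move=> fc gd sc sd cT1 cT2.
have bf := boundary_pair_boundary_value fc sc; have bg :=
  boundary_pair_boundary_value gd sd.
have Sc := square_summable_energy_cvg sc; have Sd := square_summable_energy_cvg sd.
have Sc' : energy_cvg (im_coef c) (opp_seq (re_coef c))
  (limn (series (fun k => cmod (c k) ^+ 2))).
  rewrite /energy_cvg; apply: cvg_trans Sc; apply: near_eq_cvg; apply: nearW => N.
  by apply: eq_bigr => k _; rewrite /opp_seq sqrrN addrC.
have E1 := boundary_inner Sc Sd cT1 bf bg.
have E2 := boundary_inner (T := T2) Sc' Sd _ (boundary_pair_rot (energy_cvg_le Sc) bf)
  bg.
rewrite /hardy_inner /complex_integral.
rewrite (_ : \int[mu]_(t in `[0, 2 * pi]) complex.Re _ = 2 * pi * T1); last first.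
  rewrite -E1; apply: eq_Rintegral => t _.
  by case: (boundary_value f t) (boundary_value g t) => ? ? [? ?] /=; ring.
rewrite (_ : \int[mu]_(t in `[0, 2 * pi]) complex.Im _ = 2 * pi * T2); last first.
  rewrite -E2.
    apply: eq_Rintegral => t _.
    by case: (boundary_value f t) (boundary_value g t) => ? ? [? ?] /=; ring.
  apply: cvg_trans cT2; apply: near_eq_cvg; apply: nearW => N.
  by apply: eq_bigr => k _; rewrite /opp_seq; ring.
have p0 : 2 * pi != 0 :> R by rewrite gt_eqF ?pi2_gt0.
by apply/eqP; rewrite eq_complex /= !mul0r subr0 addr0 !mulKf// !eqxx.
Qed.

End complex_series.

(** * The inner product of coefficient sequences *)

Section hilbert.
Variable R : realType.
Set Implicit Arguments. Unset Strict Implicit.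
Local Notation C := R[i].
Implicit Types (b c d : nat -> C) (x z s : C).

(** A relation rather than a limit, so that sums and products can be combined
    before a limit is named. *)
Definition has_inner c d (T : C) :=
  (fun N => \sum_(0 <= k < N) c k * (d k)^* : R[i]^o) @ \oo --> (T : R[i]^o).

Lemma has_inner_unique c d T T' : has_inner c d T -> has_inner c d T' -> T = T'.
Proof. move=> h h'; have := @cvg_unique R[i]^o (@norm_hausdorff _ R[i]^o) _ _ _ _
  h h'; exact. Qed.

Lemma has_inner_linl c c' d T T' z : has_inner c d T -> has_inner c' d T' ->
  has_inner (fun k => c k + z * c' k) d (T + z * T').
Proof.
move=> h h'; rewrite /has_inner; apply: cvgC_ext => [|N|].
- by apply: cvgC_D; [exact: h|apply: cvgC_M; [exact: (@cvgC_cst _ _ _ _ z)|exact: h']].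
- by rewrite /= big_distrr/= -big_split/=; apply: eq_bigr => k _; ring.
- by [].
Qed.

Arguments has_inner_linl [c c' d T T'] z _ _.

Lemma has_inner_conj c d T : has_inner c d T -> has_inner d c T^*.
Proof.
move=> h; rewrite /has_inner; apply: cvgC_ext => [|N|];
  [by apply: cvgC_conj; exact: h| |by []].
by rewrite /= rmorph_sum/=; apply: eq_bigr => k _; rewrite rmorphM/= conjcK mulrC.
Qed.

Lemma has_inner_linr c d d' T T' z : has_inner c d T -> has_inner c d' T' ->
  has_inner c (fun k => d k + z * d' k) (T + z^* * T').
Proof.
move=> /has_inner_conj h /has_inner_conj h'; have :=
  has_inner_conj (has_inner_linl z h h').
by rewrite rmorphD rmorphM /= !conjcK.
Qed.

Arguments has_inner_linr [c d d' T T'] z _ _.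

Lemma mul_conj z : z * z^* = (cmod z ^+ 2)%:C.
Proof. by rewrite cmod_sqr; case: z => a b; apply/eqP; rewrite eq_complex /=;
  apply/andP; split; apply/eqP; ring. Qed.

Definition coef_energy c : R := limn (series (fun k => cmod (c k) ^+ 2)).

Lemma sum_realC (f : nat -> R) N : \sum_(0 <= k < N) (f k)%:C =
  (\sum_(0 <= k < N) f k)%:C :> C.
Proof. by rewrite rmorph_sum. Qed.

Lemma cvg_real (u : nat -> R) (l : R) :
  ((fun n => (u n)%:C : R[i]^o) @ \oo --> (l%:C : R[i]^o)) <-> (u @ \oo --> l).
Proof.
split=> [/cvgCP[]//|h]; apply/cvgCP; split => //; exact: cvg_cst.
Qed.

Lemma has_innerxx c S : has_inner c c S%:C <->
  (series (fun k => cmod (c k) ^+ 2) @ \oo --> S).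
Proof.
rewrite -cvg_real; rewrite /has_inner (_ : (fun N => _) =
  (fun n => (series (fun k => cmod (c k) ^+ 2) n)%:C : R[i]^o))//.
by apply/funext => N; rewrite /series/= -sum_realC; apply: eq_bigr => k _;
  rewrite mul_conj.
Qed.

Lemma square_summableP c : square_summable c -> has_inner c c (coef_energy c)%:C.
Proof. by move=> h; apply/has_innerxx. Qed.

Lemma has_inner_square_summable c S : has_inner c c S%:C -> square_summable c /\
  coef_energy c = S.
Proof. by move=> /has_innerxx h; split; [exact: cvgP h|exact/cvg_lim]. Qed.

Lemma square_summable_bounded c (A : R) :
  (forall N, \sum_(0 <= k < N) cmod (c k) ^+ 2 <= A) -> square_summable c.
Proof.
move=> H; apply: nondecreasing_is_cvgn; last by exists A => _ [n _ <-]; exact: H.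
move=> m n mn; rewrite /series/= (@big_cat_nat _ _ _ m 0 n)//= lerDl sumr_ge0// => i _.
by rewrite sqr_ge0.
Qed.

Lemma partial_energy_le c N : square_summable c ->
  \sum_(0 <= k < N) cmod (c k) ^+ 2 <= coef_energy c.
Proof.
move=> H; apply: (nondecreasing_cvgn_le _ H) => m n mn.
rewrite /series/= (@big_cat_nat _ _ _ m 0 n)//= lerDl sumr_ge0// => i _.
by rewrite sqr_ge0.
Qed.

Lemma series_dom (u v : nat -> R) : (forall k, `|u k| <= v k) -> cvgn (series v) ->
  cvgn (series u).
Proof.
move=> uv cv; apply: normed_cvg; apply: series_le_cvg cv => k /=;
  [exact: normr_ge0| |exact: uv].
exact: (le_trans (normr_ge0 _) (uv k)).
Qed.

Lemma cmod_mul_conj_le z w : cmod (z * w^*) <= cmod z ^+ 2 + cmod w ^+ 2.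
Proof.
have -> : cmod (z * w^*) = cmod z * cmod w.
  by rewrite cmodM; congr (_ * _); rewrite !cmodE; case: (w) => a b /=; rewrite sqrrN.
by have := cmod_ge0 z; have := cmod_ge0 w; have := sqr_ge0 (cmod z - cmod w); nra.
Qed.

Lemma has_inner_ex c d : square_summable c -> square_summable d -> exists T,
  has_inner c d T.
Proof.
move=> hc hd.
have hcd : cvgn (series (fun k => cmod (c k) ^+ 2 + cmod (d k) ^+ 2)).
  rewrite (_ : series _ = series (fun k => cmod (c k) ^+ 2) +
    series (fun k => cmod (d k) ^+ 2)).
    exact: is_cvgD.
  by apply/funext => N; rewrite /series/= fctE big_split.
have h1 : cvgn (series (fun k => complex.Re (c k * (d k)^*))).
  by apply: series_dom hcd => k; apply: le_trans (Re_le_cmod _) (cmod_mul_conj_le _ _).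
have h2 : cvgn (series (fun k => complex.Im (c k * (d k)^*))).
  by apply: series_dom hcd => k; apply: le_trans (Im_le_cmod _) (cmod_mul_conj_le _ _).
exists (limn (series (fun k => complex.Re (c k * (d k)^*))) +i*
        limn (series (fun k => complex.Im (c k * (d k)^*)))).
apply/cvgCP; split => /=.
  by apply: cvg_trans h1; apply: near_eq_cvg; apply: nearW => N; rewrite Re_sum.
by apply: cvg_trans h2; apply: near_eq_cvg; apply: nearW => N; rewrite Im_sum.
Qed.

Definition coef_inner c d : C := xget 0 [set T | has_inner c d T].

Lemma coef_innerP c d : square_summable c -> square_summable d ->
  has_inner c d (coef_inner c d).
Proof. by move=> hc hd; have [T hT] := has_inner_ex hc hd; rewrite /coef_inner;
  case: xgetP => [//|/(_ T)]. Qed.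

Lemma coef_innerE c d T : has_inner c d T -> coef_inner c d = T.
Proof.
move=> h; rewrite /coef_inner; case: xgetP => [T' _ h'|/(_ T)//];
  exact: has_inner_unique h' h.
Qed.

Lemma hardy_inner_coef f g c d : taylor_expansion f c -> taylor_expansion g d ->
  square_summable c -> square_summable d -> hardy_inner f g = coef_inner c d.
Proof.
move=> fc gd hc hd; have /cvgCP[h1 h2] := coef_innerP hc hd.
have -> : coef_inner c d =
  complex.Re (coef_inner c d) +i* complex.Im (coef_inner c d) by case: (coef_inner c d).
apply: hardy_innerE fc gd hc hd _ _.
  apply: cvg_trans h1; apply: near_eq_cvg; apply: nearW => N.
  rewrite Re_sum; apply: eq_bigr => k _; rewrite /re_coef /im_coef.
  by case: (c k) (d k) => ? ? [? ?] /=; ring.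
apply: cvg_trans h2; apply: near_eq_cvg; apply: nearW => N.
rewrite Im_sum; apply: eq_bigr => k _; rewrite /re_coef /im_coef.
by case: (c k) (d k) => ? ? [? ?] /=; ring.
Qed.

(** Pythagoras: subtracting the orthogonal projection onto a unit vector. *)
Lemma coef_energy_subZ c b : square_summable c -> square_summable b ->
  coef_energy b = 1 ->
  square_summable (fun k => c k + - coef_inner c b * b k) /\
  coef_energy (fun k => c k + - coef_inner c b * b k) = coef_energy c -
    cmod (coef_inner c b) ^+ 2.
Proof.
move=> hc hb b1; apply: has_inner_square_summable.
have cc := square_summableP hc; have bb := square_summableP hb; have cb :=
  coef_innerP hc hb; have bc := has_inner_conj cb.
have := has_inner_linr (- coef_inner c b) (has_inner_linl (- coef_inner c b) cc bc)
  (has_inner_linl (- coef_inner c b) cb bb).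
rewrite b1 rmorphB/= -mul_conj; congr (has_inner _ _ _).
rewrite rmorphN/=; ring.
Qed.

(** Subtracts one projection at a time, each computed from the original
    sequence; for an orthonormal system this agrees with projecting the
    successive residuals. *)
Fixpoint coef_residual c (B : nat -> nat -> C) n : nat -> C :=
  if n is m.+1 then (fun k => coef_residual c B m k + - coef_inner c (B m) * B m k)
    else c.

Lemma coef_residual_energy c (B : nat -> nat -> C) n : square_summable c ->
  (forall j, (j < n)%N -> square_summable (B j)) ->
  (forall i j, (i < n)%N -> (j < n)%N -> coef_inner (B i) (B j) = (i == j)%:R) ->
  square_summable (coef_residual c B n) /\ coef_energy (coef_residual c B n) =
    coef_energy c - \sum_(j < n) cmod (coef_inner c (B j)) ^+ 2.
Proof.
move=> hc; move: n.
have aux m : forall j, (forall j, (j < m)%N -> square_summable (B j)) ->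
  square_summable (B j) ->
   (forall i, (i < m)%N -> coef_inner (B i) (B j) = 0) ->
     has_inner (coef_residual c B m) (B j) (coef_inner c (B j)).
  move=> j; elim: m => [|m IH] hB hj o /=; first exact: coef_innerP.
  have h1 : has_inner (coef_residual c B m) (B j) (coef_inner c (B j)).
    by apply: IH => // i im; [apply: hB|apply: o]; exact: ltnW.
  have h2 : has_inner (B m) (B j) 0.
    by have := coef_innerP (hB m (ltnSn m)) hj; rewrite (o m (ltnSn m)).
  by have := has_inner_linl (- coef_inner c (B m)) h1 h2; rewrite mulr0 addr0; exact.
elim=> [|n IH] hB o; first by rewrite big_ord0 subr0.
have [h1 h2] : square_summable (coef_residual c B n) /\
   coef_energy (coef_residual c B n) = coef_energy c -
     \sum_(j < n) cmod (coef_inner c (B j)) ^+ 2.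
  by apply: IH => [j jn|i j iN jn]; [exact/hB/ltnW|apply: o; exact: ltnW].
have hn := hB n (ltnSn n).
have n1 : coef_energy (B n) = 1.
  by have := coef_innerE (square_summableP hn); rewrite o// eqxx => -[].
have E : coef_inner (coef_residual c B n) (B n) = coef_inner c (B n).
  apply: coef_innerE; apply: aux => // [j jn|i iN]; first exact/hB/ltnW.
  by rewrite (o i n (ltnW iN) (ltnSn n)) ltn_eqF.
have := coef_energy_subZ h1 hn n1; rewrite E => -[h3 h4]; split => //=.
by rewrite h4 h2 big_ord_recr/= opprD addrA.
Qed.

End hilbert.

(** * Multiplication by a Blaschke factor on coefficients *)

Section blaschke.
Variable R : realType.
Set Implicit Arguments. Unset Strict Implicit.
Local Notation C := R[i].
Implicit Types (b c d : nat -> C) (x z w s : C) (l : seq C).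

(** With d = sqrt (1 - |x|^2), the linear system s' = conj(x) s + d b,
    out = d s - x b has transfer function
    d^2 z / (1 - conj(x) z) - x = (z - x) / (1 - conj(x) z).  So its output is
    the sequence of coefficients of s e_x + phi_x g, where phi_x is the
    Blaschke factor, g has coefficients b and s is the initial state. *)
Definition defect x : C := (Num.sqrt (1 - cmod x ^+ 2))%:C.

Fixpoint col_state x s b k : C :=
  if k is k'.+1 then x^* * col_state x s b k' + defect x * b k' else s.

Definition col_output x s b k : C := defect x * col_state x s b k - x * b k.

Lemma conjM z w : ((z * w)^* = z^* * w^*)%R. Proof. exact: rmorphM. Qed.
Lemma conjD z w : ((z + w)^* = z^* + w^*)%R. Proof. exact: rmorphD. Qed.
Lemma conjB z w : ((z - w)^* = z^* - w^*)%R. Proof. exact: rmorphB. Qed.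

Lemma conj0 : ((0 : C)^* = 0)%R. Proof. exact: rmorph0. Qed.
Lemma conj1 : ((1 : C)^* = 1)%R. Proof. exact: rmorph1. Qed.

Lemma conj_defect x : ((defect x)^*)%R = defect x.
Proof. exact: conjc_real. Qed.

Lemma defect_sqr x : cmod x <= 1 -> defect x * defect x = 1 - x * x^*.
Proof.
move=> x1; rewrite mul_conj /defect -rmorphM/= -expr2 sqr_sqrtr ?rmorphB//.
by rewrite subr_ge0 expr_le1// cmod_ge0.
Qed.

Lemma col_stateS x s b k : col_state x s b k.+1 = x^* * col_state x s b k +
  defect x * b k.
Proof. by []. Qed.

(** The matrix with rows (conj(x), d) and (d, - x) is unitary. *)
Lemma colligation_unitary x s s' b b' k : cmod x <= 1 ->
  col_state x s b k.+1 * (col_state x s' b' k.+1)^* +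
    col_output x s b k * (col_output x s' b' k)^* =
  col_state x s b k * (col_state x s' b' k)^* + b k * (b' k)^*.
Proof.
move=> x1; rewrite !col_stateS /col_output;
  move: (col_state x s b k) (col_state x s' b' k) => p q.
rewrite conjB conjD !conjM conj_defect conjCK.
have D := defect_sqr x1.
transitivity ((x * x^* + defect x * defect x) * (p * q^* + b k * (b' k)^*));
  first by ring.
by rewrite D; ring.
Qed.

Lemma colligation_inner_sum x s s' b b' N : cmod x <= 1 ->
  \sum_(0 <= k < N) col_output x s b k * (col_output x s' b' k)^* =
  s * s'^* + \sum_(0 <= k < N) b k * (b' k)^* -
    col_state x s b N * (col_state x s' b' N)^*.
Proof.
move=> x1; elim: N => [|N IH]; first by rewrite !big_nil/=; ring.
rewrite !big_nat_recr// IH.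
have E := colligation_unitary s s' b b' N x1.
have -> : col_output x s b N * (col_output x s' b' N)^* =
  col_state x s b N * (col_state x s' b' N)^* + b N * (b' N)^* -
  col_state x s b N.+1 * (col_state x s' b' N.+1)^* by rewrite -E addrC addKr.
move: (col_state x s b N.+1 * (col_state x s' b' N.+1)^*)
  (col_state x s b N * (col_state x s' b' N)^*) => P Q.
by rewrite /=; ring.
Qed.

Lemma colligation_energy_sum x s b N : cmod x <= 1 ->
  \sum_(0 <= k < N) cmod (col_output x s b k) ^+ 2 + cmod (col_state x s b N) ^+ 2 =
  cmod s ^+ 2 + \sum_(0 <= k < N) cmod (b k) ^+ 2.
Proof.
move=> x1; have := colligation_inner_sum s s b b N x1.
under eq_bigr do rewrite mul_conj.
under [X in _ = _ + X - _ -> _]eq_bigr do rewrite mul_conj.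
rewrite !mul_conj !sum_realC -rmorphD -rmorphB => /(@complexI R) ->.
by rewrite subrK.
Qed.

Lemma sum_sqr_ge0 (u : nat -> C) N : 0 <= \sum_(0 <= k < N) cmod (u k) ^+ 2.
Proof. by apply: sumr_ge0 => k _; exact: sqr_ge0. Qed.

Lemma col_output_energy_le x s b N : cmod x <= 1 ->
  \sum_(0 <= k < N) cmod (col_output x s b k) ^+ 2 <=
  cmod s ^+ 2 + \sum_(0 <= k < N) cmod (b k) ^+ 2.
Proof. by move=> x1; rewrite -(colligation_energy_sum s b N x1) lerDl sqr_ge0. Qed.

Lemma square_summable_output x s b : cmod x <= 1 -> square_summable b ->
  square_summable (col_output x s b).
Proof.
move=> x1 hb; apply: (@square_summable_bounded _ _ (cmod s ^+ 2 + coef_energy b)) => N.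
by apply: le_trans (col_output_energy_le s b N x1) _; rewrite lerD2l partial_energy_le.
Qed.

Lemma defect_le1 x : cmod (defect x) <= 1.
Proof.
rewrite /defect cmod_real ger0_norm ?sqrtr_ge0// -sqrtr1 ler_sqrt ?gerBl ?sqr_ge0//.
by rewrite sqrtr1 ?gerDl ?oppr_le0 ?sqr_ge0.
Qed.

Lemma sqr_cvg0 (u : nat -> R) : (forall k, 0 <= u k) -> (fun k => u k ^+ 2) @ \oo -->
  (0 : R) ->
  u @ \oo --> (0 : R).
Proof.
move=> u0 /cvgrPdist_lt h; apply/cvgrPdist_lt => e e0.
have e2 : 0 < e ^+ 2 by rewrite exprn_gt0.
have := h _ e2; apply: filterS => k; rewrite !sub0r !normrN normrX (ger0_norm (u0 k)).
by rewrite ltr_pXn2r// nnegrE// ltW.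
Qed.

(** By the energy balance the moduli of the states converge, and
    |s_(N+1)| <= |x| |s_N| + |b_N| with b_N -> 0 forces the limit L to satisfy
    L <= |x| L. *)
Lemma col_state_cvg0 x s b : cmod x < 1 -> square_summable b ->
  (fun N => cmod (col_state x s b N)) @ \oo --> (0 : R).
Proof.
move=> x1 hb; have x1' := ltW x1.
have ho := @square_summable_output x s b x1' hb.
have c2 : (fun N => cmod (col_state x s b N) ^+ 2) @ \oo -->
  cmod s ^+ 2 + coef_energy b - coef_energy (col_output x s b).
  rewrite (_ : (fun N => _) = (fun N => cmod s ^+ 2 +
    series (fun k => cmod (b k) ^+ 2) N -
      series (fun k => cmod (col_output x s b k) ^+ 2) N)); last first.
    by apply/funext => N; rewrite /series/= -(colligation_energy_sum s b N x1'); ring.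
  by apply: cvgB => //; apply: cvgD => //; exact: cvg_cst.
set L2 := (X in _ --> X) in c2.
have c1 : (fun N => cmod (col_state x s b N)) @ \oo --> Num.sqrt L2.
  rewrite (_ : (fun N => _) = (fun N => Num.sqrt (cmod (col_state x s b N) ^+ 2)));
    last first.
    by apply/funext => N; rewrite sqrtr_sqr ger0_norm ?cmod_ge0.
  exact: (cvg_comp _ _ c2 (@sqrt_continuous _ _)).
have cb : (fun N => cmod (b N)) @ \oo --> (0 : R).
  apply: sqr_cvg0; first by move=> k; exact: cmod_ge0.
  exact: cvg_series_cvg_0 hb.
have L0 : Num.sqrt L2 <= cmod x * Num.sqrt L2 + 0.
  have cl : (fun N => cmod (col_state x s b N.+1)) @ \oo -->
    Num.sqrt L2 by rewrite -cvg_shiftS in c1.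
  have cr : (fun N => cmod x * cmod (col_state x s b N) + cmod (b N)) @ \oo -->
    cmod x * Num.sqrt L2 + 0.
    by apply: cvgD => //; apply: cvgM => //; exact: cvg_cst.
  apply: (ler_cvg_to cl cr); apply: nearW => N /=.
  apply: le_trans (cmodD _ _) _; rewrite !cmodM.
  have -> : cmod x^* = cmod x by rewrite !cmodE; case: (x) => p q /=; rewrite sqrrN.
  by rewrite lerD2l ler_piMl ?cmod_ge0// defect_le1.
suff <- : Num.sqrt L2 = 0 by [].
apply/eqP; rewrite eq_le sqrtr_ge0 andbT.
by move: L0; have := sqrtr_ge0 L2; move: x1; rewrite addr0;
  move: (cmod x) (Num.sqrt L2) => p q; nra.
Qed.

Lemma cvgC_cmod0 (u : nat -> C) : (fun n => cmod (u n)) @ \oo --> (0 : R) ->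
  (fun n => u n : R[i]^o) @ \oo --> ((0 : C) : R[i]^o).
Proof.
move=> /cvgrPdist_lt h; apply/cvgC_cmod => e e0; have := h _ e0; apply: filterS => n.
by rewrite !sub0r normrN ger0_norm ?cmod_ge0// cmodN.
Qed.

(** The map from (initial state, input) to the output is an isometry.  This
    one statement says that multiplication by phi_x is isometric, that e_x is
    a unit vector, and that e_x is orthogonal to every multiple of phi_x. *)
Lemma has_inner_output x s s' b b' T : cmod x < 1 -> square_summable b ->
  square_summable b' -> has_inner b b' T ->
  has_inner (col_output x s b) (col_output x s' b') (s * s'^* + T).
Proof.
move=> x1 hb hb' h.
have c1 := cvgC_cmod0 (@col_state_cvg0 x s b x1 hb).
have c2 := cvgC_cmod0 (@col_state_cvg0 x s' b' x1 hb').
rewrite /has_inner; apply: cvgC_ext => [|N|].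
- apply: cvgC_D; first by apply: cvgC_D;
  [exact: (@cvgC_cst _ _ _ _ (s * s'^*))|exact: h].
  apply: cvgC_M; first exact: (@cvgC_cst _ _ _ _ (-1)).
  by apply: cvgC_M; [exact: c1|apply: cvgC_conj; exact: c2].
- by rewrite /= colligation_inner_sum ?ltW// mulN1r.
- by rewrite conjc0 mulr0 mulr0 addr0.
Qed.

Definition nullseq : nat -> C := fun=> 0.

Definition blaschke_mul x b := col_output x 0 b.
Definition szego_coef x := col_output x 1 nullseq.

(** Coefficients of the k-th function of the system generated by the list.
    The recursion removes the first parameter x, whose square factor
    phi_x^2 is common to all later functions. *)
Fixpoint tm_coef l k : nat -> C :=
  if l is x :: l' then (if k is k'.+1 then blaschke_mul x
    (blaschke_mul x (tm_coef l' k')) else szego_coef x)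
  else nullseq.

Lemma sum_nullseq N : \sum_(0 <= k < N) cmod (nullseq k) ^+ 2 = 0.
Proof. by apply: big1 => k _; rewrite /nullseq cmodE/= expr0n/= addr0 sqrtr0 expr0n.
  Qed.

Lemma square_summable_null : square_summable nullseq.
Proof. by apply: (@square_summable_bounded _ _ 0) => N; rewrite sum_nullseq. Qed.

(** Valid up to the unit circle, unlike orthonormality: this uniform bound is
    what makes inner products with the system continuous there. *)
Lemma tm_coef_energy_le l k N : all (fun x => cmod x <= 1) l ->
  \sum_(0 <= j < N) cmod (tm_coef l k j) ^+ 2 <= 1.
Proof.
elim: l k => [|x l IH] k /=; first by rewrite sum_nullseq.
move=> /andP[x1 hl]; case: k => [|k].
  apply: le_trans (col_output_energy_le _ _ _ x1) _; rewrite sum_nullseq addr0.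
  by rewrite cmodE/= expr1n expr0n/= addr0 sqrtr1 expr1n.
apply: le_trans (col_output_energy_le _ _ _ x1) _.
rewrite [cmod 0](_ : _ = 0) ?expr0n ?add0r;
  last by rewrite cmodE/= expr0n/= addr0 sqrtr0.
apply: le_trans (col_output_energy_le _ _ _ x1) _.
rewrite [cmod 0](_ : _ = 0) ?expr0n ?add0r;
  last by rewrite cmodE/= expr0n/= addr0 sqrtr0.
exact: IH.
Qed.

Lemma square_summable_tm l k : all (fun x => cmod x <= 1) l ->
  square_summable (tm_coef l k).
Proof. by move=> hl; apply: (@square_summable_bounded _ _ 1) => N;
  exact: tm_coef_energy_le. Qed.

Lemma all_lt_le l : all (fun x => cmod x < 1) l -> all (fun x => cmod x <= 1) l.
Proof. by apply: sub_all => x /ltW. Qed.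

Lemma tm_coef_orthonormal l i j : all (fun x => cmod x < 1) l -> (i < size l)%N ->
  (j < size l)%N ->
  has_inner (tm_coef l i) (tm_coef l j) (i == j)%:R.
Proof.
elim: l i j => // x l IH i j /= /andP[x1 hl].
have x1' := ltW x1; have hl' := all_lt_le hl.
have hn := square_summable_null; have hb k := @square_summable_tm l k hl'.
have hb2 k := @square_summable_output x 0 _ x1' (hb k).
have nul b : has_inner nullseq b 0.
  rewrite /has_inner; apply: cvgC_ext => [|N|]; first exact: (@cvgC_cst _ _ _ _ 0).
    by rewrite big1// => k _; rewrite /nullseq mul0r.
  by [].
have ker_bmul k : has_inner (szego_coef x)
  (blaschke_mul x (blaschke_mul x (tm_coef l k))) 0.
  have := has_inner_output (s := 1) (s' := 0) x1 hn (hb2 k) (nul _).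
  by rewrite conj0 mulr0 addr0; exact.
case: i j => [|i] [|j] /=; rewrite ?ltnS => il jl.
- have := has_inner_output (s := 1) (s' := 1) x1 hn hn (nul _).
  by rewrite conj1 mulr1 addr0; exact.
- exact: ker_bmul.
- by have := has_inner_conj (ker_bmul i); rewrite conjc0; exact.
have h := IH i j hl il jl.
have h1 := has_inner_output (s := 0) (s' := 0) x1 (hb i) (hb j) h.
have := has_inner_output (s := 0) (s' := 0) x1 (hb2 i) (hb2 j) h1.
by rewrite mul0r !add0r eqSS; exact.
Qed.

End blaschke.

(** * Taylor expansions *)

Section taylor.
Variable R : realType.
Set Implicit Arguments. Unset Strict Implicit.
Local Notation C := R[i].
Implicit Types (b c d : nat -> C) (x z w s : C) (l : seq C) (f g : C -> C).

Lemma taylor_ext f g c : (forall z, unit_disc z -> f z = g z) ->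
  taylor_expansion f c -> taylor_expansion g c.
Proof. by move=> fg fc z Dz; rewrite -fg//; exact: fc. Qed.

Lemma taylor_lin f g c d w : taylor_expansion f c -> taylor_expansion g d ->
  taylor_expansion (fun z => f z + w * g z) (fun k => c k + w * d k).
Proof.
move=> fc gd z Dz; apply: cvgC_ext => [|N|].
- apply: cvgC_D; first exact: (fc z Dz).
  by apply: cvgC_M; [exact: (@cvgC_cst _ _ _ _ w)|exact: (gd z Dz)].
- rewrite /series /= big_distrr/= -big_split/=; apply: eq_bigr => k _; ring.
- by [].
Qed.

Arguments taylor_lin [f g c d] w _ _.

(** Summing the state recursion against z^k telescopes. *)
Lemma col_state_series x s b z N :
  (1 - x^* * z) * (\sum_(0 <= k < N) col_state x s b k * z ^+ k) =
  s + defect x * z * (\sum_(0 <= k < N) b k * z ^+ k) - col_state x s b N * z ^+ N.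
Proof.
elim: N => [|N IH]; first by rewrite !big_nil/= expr0; ring.
rewrite !big_nat_recr//= mulrDr IH exprS; ring.
Qed.

Lemma cmod_conj x : cmod (x^*)%R = cmod x.
Proof. by rewrite !cmodE; case: x => p q /=; rewrite sqrrN. Qed.

Lemma cmod0 : cmod (0 : C) = 0.
Proof. by rewrite cmodE/= expr0n/= addr0 sqrtr0. Qed.

Lemma cmod1 : cmod (1 : C) = 1.
Proof. by rewrite cmodE/= expr0n/= addr0 expr1n sqrtr1. Qed.

Lemma cmodX x n : cmod (x ^+ n) = cmod x ^+ n.
Proof. by elim: n => [|n IH]; [rewrite !expr0 cmod1|rewrite !exprS cmodM IH]. Qed.

Lemma denom_neq0 x z : cmod x <= 1 -> cmod z < 1 -> 1 - x^* * z != 0.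
Proof.
move=> x1 z1; apply/negP; rewrite subr_eq0 => /eqP E.
have : cmod (1 : C) < 1; last by rewrite cmod1 ltxx.
rewrite E cmodM cmod_conj; apply: le_lt_trans z1.
by rewrite ler_piMl// cmod_ge0.
Qed.

Lemma taylor_output x s b g : cmod x < 1 -> square_summable b -> taylor_expansion g b ->
  taylor_expansion (fun z => s * szego_kernel x z + (z - x) / (1 - x^* * z) * g z)
    (col_output x s b).
Proof.
move=> x1 hb gb z Dz; have d0 := denom_neq0 (ltW x1) Dz.
have st0 : (fun N => col_state x s b N * z ^+ N : R[i]^o) @ \oo --> ((0 : C) : R[i]^o).
  apply: cvgC_cmod0; rewrite (_ : (fun n => _) =
    (fun N => cmod (col_state x s b N) * cmod z ^+ N)); last first.
    by apply/funext => N; rewrite cmodM cmodX.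
  rewrite -[X in _ --> X](mulr0 (0 : R)); apply: cvgM; first exact: col_state_cvg0.
  by apply: cvg_expr; rewrite ger0_norm ?cmod_ge0.
apply: cvgC_ext => [|N|].
- apply: cvgC_D.
    apply: cvgC_M; first exact: (@cvgC_cst _ _ _ _ (defect x / (1 - x^* * z))).
    apply: cvgC_D.
      apply: cvgC_D; first exact: (@cvgC_cst _ _ _ _ s).
      apply: cvgC_M; first exact: (@cvgC_cst _ _ _ _ (defect x * z)).
      exact: (gb z Dz).
    by apply: cvgC_M; [exact: (@cvgC_cst _ _ _ _ (-1))|exact: st0].
  by apply: cvgC_M; [exact: (@cvgC_cst _ _ _ _ (- x))|exact: (gb z Dz)].
- rewrite /series /=.
  have E := col_state_series x s b z N.
  rewrite mulN1r -E mulrA divfK// mulNr !big_distrr/= -sumrN -big_split/=.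
  by apply: eq_bigr => k _; rewrite /col_output; ring.
- rewrite /szego_kernel -/(defect x) /=.
  have D := defect_sqr (ltW x1).
  have -> : defect x / (1 - x^* * z) * (s + defect x * z * g z + -1 * 0) + - x * g z =
    s * (defect x / (1 - x^* * z)) +
      ((defect x * defect x) * z - x * (1 - x^* * z)) / (1 - x^* * z) * g z.
    by field.
  by rewrite D; congr (_ + _ / _ * _); ring.
Qed.

Lemma series_bounded (u : nat -> R) : cvgn (series u) -> exists M, forall k, `|u k| <=
  M.
Proof.
move=> /cvg_series_cvg_0 h; have := cvg_seq_bounded (cvgP _ h).
move=> [M [_ HM]]; exists (M + 1) => k; apply: HM => //.
by rewrite ltrDl.
Qed.

(** Convergence at 1/2 bounds c_k by M 2^k.  If all coefficients below m
    vanish, evaluating at a small r > 0 and dividing by r^m leaves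
    |c_m| <= M 2^(m+2) r. *)
Lemma taylor_zero c : taylor_expansion (fun=> 0) c -> forall k, c k = 0.
Proof.
move=> h0.
have half : unit_disc ((2^-1 : R)%:C).
  by rewrite /unit_disc/= cmod_real ger0_norm ?invr_ge0// invf_lt1// ltr1n.
have /cvgCP[cR cI] := h0 _ half.
have [M1 HM1] : exists M, forall k, `|complex.Re (c k * ((2^-1 : R)%:C) ^+ k)| <= M.
  apply: series_bounded; apply: cvgP; apply: cvg_trans cR.
  by apply: near_eq_cvg; apply: nearW => N; rewrite /series/= Re_sum.
have [M2 HM2] : exists M, forall k, `|complex.Im (c k * ((2^-1 : R)%:C) ^+ k)| <= M.
  apply: series_bounded; apply: cvgP; apply: cvg_trans cI.
  by apply: near_eq_cvg; apply: nearW => N; rewrite /series/= Im_sum.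
pose M := M1 + M2.
have cM k : cmod (c k) <= M * 2 ^+ k.
  have : cmod (c k) * 2^-1 ^+ k <= M.
    have -> : cmod (c k) * 2^-1 ^+ k = cmod (c k * ((2^-1 : R)%:C) ^+ k).
      by rewrite cmodM cmodX cmod_real ger0_norm ?invr_ge0.
    by apply: le_trans (cmod_le_ReIm _) _; apply: lerD.
  by rewrite exprVn ler_pdivrMr ?exprn_gt0.
have M0 : 0 <= M by have := cM 0%N; rewrite expr0 mulr1; apply: le_trans;
  exact: cmod_ge0.
move=> k; elim/ltn_ind: k => m IH.
have key (rr : R) : 0 < rr <= 4^-1 -> cmod (c m) <= M * 2 ^+ m.+2 * rr.
  move=> /andP[r0 r4].
  have D : unit_disc (rr%:C : C).
    by rewrite /unit_disc/= cmod_real (ger0_norm (ltW r0)); lra.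
  have /cvgC_cmod hz := h0 _ D.
  have rm0 : 0 < rr ^+ m by rewrite exprn_gt0.
  rewrite -(ler_pM2r rm0); apply/ler_addgt0Pr => e e0.
  have [N0 _ HN0] := hz e e0.
  pose N := (maxn N0 m.+1).
  have := HN0 N (leq_maxl _ _); rewrite /= sub0r cmodN /series/= => hN.
  have mN : (m < N)%N by exact: leq_maxr.
  have S1 : \sum_(0 <= k < N) c k * rr%:C ^+ k =
     c m * rr%:C ^+ m + \sum_(m.+1 <= k < N) c k * rr%:C ^+ k.
    rewrite (@big_cat_nat _ _ _ m.+1)//= big_nat_recr//=; congr (_ + _).
    rewrite big_nat_cond big1 ?add0r// => k /andP[/andP[_ km] _].
    by rewrite IH// mul0r.
  have S2 : cmod (\sum_(m.+1 <= k < N) c k * rr%:C ^+ k) <=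
    M * 2 ^+ m.+2 * rr * rr ^+ m.
    apply: (@le_trans _ _ (\sum_(m.+1 <= k < N) M * (2 * rr) ^+ k)).
      elim/big_ind2: _ => [|p1 p2 q1 q2 h1 h2|k _]; first by rewrite cmod0.
        by apply: le_trans (cmodD _ _) _; exact: lerD.
      rewrite cmodM cmodX cmod_real (ger0_norm (ltW r0)) exprMn mulrA ler_wpM2r ?cM//.
      by rewrite exprn_ge0// ltW.
    rewrite -big_distrr/=.
    have r2 : 0 <= 2 * rr < 1 by apply/andP; split; lra.
    apply: (@le_trans _ _ (M * ((2 * rr) ^+ m.+1 / (1 - 2 * rr)))).
      by rewrite ler_wpM2l// sum_geometric_le.
    have -> : M * 2 ^+ m.+2 * rr * rr ^+ m = M * (2 * (2 * rr) ^+ m.+1).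
      by rewrite exprMn !exprS; ring.
    rewrite ler_wpM2l// ler_pdivrMr; last by lra.
    have : 0 <= (2 * rr) ^+ m.+1 by rewrite exprn_ge0//; lra.
    by move: (_ ^+ m.+1) => P P0; nra.
  have -> : cmod (c m) * rr ^+ m = cmod (c m * rr%:C ^+ m).
    by rewrite cmodM cmodX cmod_real ger0_norm ?ltW.
  have -> : c m * rr%:C ^+ m = \sum_(0 <= k < N) c k * rr%:C ^+ k -
    \sum_(m.+1 <= k < N) c k * rr%:C ^+ k by rewrite S1 addrK.
  apply: le_trans (cmodD _ _) _; rewrite cmodN addrC; apply: lerD => //.
  exact: ltW.
have : cmod (c m) <= 0.
  apply/ler_addgt0Pr => e e0; rewrite add0r.
  pose q := M * 2 ^+ m.+2.
  have q0 : 0 <= q by rewrite mulr_ge0// exprn_ge0.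
  have q1 : 0 < q + 1 by lra.
  pose rr := Num.min 4^-1 (e / (q + 1)).
  have r0 : 0 < rr by rewrite lt_min; apply/andP; split;
    [rewrite invr_gt0|exact: divr_gt0].
  have r4 : rr <= 4^-1 by rewrite ge_min lexx.
  have re : rr * (q + 1) <= e by rewrite -ler_pdivlMr// ge_min lexx orbT.
  have := key rr; rewrite r0 r4 => /(_ isT) /le_trans; apply.
  by rewrite -/q; nra.
move=> h; have : cmod (c m) = 0 by apply/eqP; rewrite eq_le h cmod_ge0.
move=> e; have := norm_cmod (c m); rewrite e => /eqP; rewrite normr_eq0 => /eqP.
exact.
Qed.

Lemma taylor_unique f c d : taylor_expansion f c -> taylor_expansion f d -> c = d.
Proof.
move=> fc fd; apply/funext => k; apply/eqP; rewrite -subr_eq0; apply/eqP.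
have h := taylor_lin (-1) fc fd.
have h2 : taylor_expansion (fun=> 0) (fun k => c k + -1 * d k).
  by apply: taylor_ext h => z _; rewrite mulN1r subrr.
by have := taylor_zero h2 k; rewrite mulN1r.
Qed.

Lemma taylor_coefE f c : taylor_expansion f c -> taylor_coef f = c.
Proof.
move=> fc; rewrite /taylor_coef; case: xgetP => [d _ fd|/(_ c)//].
exact: taylor_unique fd fc.
Qed.

Lemma hardy_normE f c : taylor_expansion f c -> hardy_norm f = Num.sqrt (coef_energy c).
Proof. by move=> fc; rewrite /hardy_norm (taylor_coefE fc). Qed.

End taylor.

(** * The energy captured by a system *)

Section system.
Variable R : realType.
Set Implicit Arguments. Unset Strict Implicit.
Local Notation C := R[i].
Implicit Types (b c d : nat -> C) (x z w s : C) (l : seq C) (f g : C -> C).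

Definition blaschke_factor x z : C := (z - x) / (1 - x^* * z).

Fixpoint tm_fun l k z : C :=
  if l is x :: l' then (if k is k'.+1 then blaschke_factor x z *
    (blaschke_factor x z * tm_fun l' k' z) else szego_kernel x z)
  else 0.

Lemma taylor_tm_fun l k : all (fun x => cmod x < 1) l ->
  taylor_expansion (tm_fun l k) (tm_coef l k).
Proof.
have null : taylor_expansion (fun=> 0 : C) (@nullseq R).
  move=> z Dz; apply: cvgC_ext => [|N|]; first exact: (@cvgC_cst _ _ _ _ 0).
    by rewrite /series/= big1// => i _; rewrite /nullseq mul0r.
  by [].
elim: l k => [|x l IH] k; first by move=> _; exact: null.
move=> /= /andP[x1 hl]; have hl' := all_lt_le hl; have x1' := ltW x1.
case: k => [|k].
  have := taylor_output (s := 1) x1 (@square_summable_null R) null.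
  by apply: taylor_ext => z _; rewrite mul1r mulr0 addr0.
have h0 := @square_summable_tm R l k hl'.
have h1 := taylor_output (s := 0) x1 h0 (IH k hl).
have := taylor_output (s := 0) x1 (@square_summable_output R x 0 _ x1' h0) h1.
by apply: taylor_ext => z _; rewrite !mul0r !add0r.
Qed.

Lemma tm_funE l k z : (k < size l)%N ->
  tm_fun l k z = szego_kernel (nth 0 l k) z * \prod_(j <
    k) blaschke_factor (nth 0 l j) z ^+ 2.
Proof.
elim: l k => // x l IH [|k] /= kl; first by rewrite big_ord0 mulr1.
rewrite IH// big_ord_recl/= expr2; ring.
Qed.

Lemma double_TM_tm_fun n (a : 'I_n -> C) (k : 'I_n) z :
  double_TM a k z = tm_fun [seq a i | i <- enum 'I_n] k z.
Proof.
have nthE (i : 'I_n) : nth 0 [seq a i | i <- enum 'I_n] i = a i.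
  by rewrite (nth_map i) ?size_enum_ord// nth_ord_enum.
have sl : size [seq a i | i <- enum 'I_n] = n by rewrite size_map size_enum_ord.
rewrite tm_funE ?sl// nthE /double_TM; congr (_ * _).
rewrite (big_ord_widen n (fun j =>
  blaschke_factor (nth 0 [seq a i | i <- enum 'I_n] j) z ^+ 2)) ?(ltnW (ltn_ord k))//.
by apply: eq_bigr => j _; rewrite nthE.
Qed.

Definition captured_energy c l : R :=
  \sum_(j < size l) cmod (coef_inner c (tm_coef l j)) ^+ 2.

(** Orthonormality turns the residual into the energy that the system does not
    capture. *)
Lemma hardy_norm_residual n f c (a : 'I_n -> C) : taylor_expansion f c ->
  square_summable c ->
  disc_tuple a ->
  hardy_norm (double_TM_residual f a) =
  Num.sqrt (coef_energy c - captured_energy c [seq a i | i <- enum 'I_n]).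
Proof.
move=> fc hc Da; set l := [seq a i | i <- enum 'I_n].
have sl : size l = n by rewrite size_map size_enum_ord.
have hl : all (fun x => cmod x < 1) l by apply/allP => _ /mapP[i _ ->]; exact: Da.
have hl' := all_lt_le hl.
have hB j := @square_summable_tm R l j hl'.
have te (j : 'I_n) : taylor_expansion (double_TM a j) (tm_coef l j).
  by apply: (taylor_ext _ (@taylor_tm_fun l j hl)) => z _; rewrite double_TM_tm_fun.
have ie (j : 'I_n) : hardy_inner f (double_TM a j) = coef_inner c (tm_coef l j).
  exact: (hardy_inner_coef fc (te j) hc (hB j)).
have [h1 h2] := @coef_residual_energy R c (tm_coef l) n hc (fun j _ => hB j)
  (fun i j hi hj => coef_innerE
    (@tm_coef_orthonormal R l i j hl (eq_ind_r (fun m => (i < m)%N) hi sl)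
     (eq_ind_r (fun m => (j < m)%N) hj sl))).
rewrite (@hardy_normE R _ (coef_residual c (tm_coef l) n)).
  by rewrite h2 /captured_energy sl.
have gen m : (m <= n)%N -> taylor_expansion
  (fun z => f z - \sum_(j < m) coef_inner c (tm_coef l j) * tm_fun l j z)
    (coef_residual c (tm_coef l) m).
  elim: m => [_|m IH mn].
    by apply: (taylor_ext _ fc) => z _; rewrite big_ord0 subr0.
  have := @taylor_lin R _ _ _ _ (- coef_inner c (tm_coef l m)) (IH (ltnW mn))
    (@taylor_tm_fun l m hl).
  by apply: taylor_ext => z _; rewrite big_ord_recr/=; ring.
apply: (taylor_ext _ (gen n (leqnn n))) => z _; rewrite /double_TM_residual;
  congr (_ - _).
by apply: eq_bigr => j _; rewrite ie double_TM_tm_fun.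
Qed.

Lemma defect_circle x : cmod x = 1 -> defect x = 0.
Proof. by move=> x1; rewrite /defect x1 expr1n subrr sqrtr0. Qed.

Lemma szego_coef_circle x : cmod x = 1 -> szego_coef x = @nullseq R.
Proof.
move=> x1; apply/funext => k;
  rewrite /szego_coef /col_output defect_circle// mul0r /nullseq mulr0 subr0.
by [].
Qed.

Lemma blaschke_mul_circle x b : cmod x = 1 -> blaschke_mul x b = (fun k => - x * b k).
Proof.
by move=> x1; apply/funext => k;
  rewrite /blaschke_mul /col_output defect_circle// mul0r sub0r mulNr.
Qed.

Lemma coef_innerZr c b w : square_summable c -> square_summable b ->
  coef_inner c (fun k => w * b k) = w^* * coef_inner c b.
Proof.
move=> hc hb; apply: coef_innerE; have cb := coef_innerP hc hb.
rewrite /has_inner; apply: cvgC_ext => [|N|].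
- by apply: cvgC_M; [exact: (@cvgC_cst _ _ _ _ (w^*)%R)|exact: cb].
- by rewrite /= big_distrr/=; apply: eq_bigr => k _; rewrite conjM; ring.
- by [].
Qed.

Lemma blaschke_mulZ x w b : blaschke_mul x (fun k => w * b k) =
  (fun k => w * blaschke_mul x b k).
Proof.
apply/funext => k; rewrite /blaschke_mul /col_output.
have -> : col_state x 0 (fun k => w * b k) k = w * col_state x 0 b k.
  by elim: k => [|k IH] /=; [rewrite mulr0|rewrite IH; ring].
by ring.
Qed.

(** A parameter x with |x| = 1 contributes the zero function, and multiplies
    all later functions by the unimodular constant x^2.  The operator L stands
    for multiplication by the factors of the parameters already passed; all
    that is used of it is that it commutes with scalars and preserves
    square-summability. *)
Lemma captured_energy_filter c l (L : (nat -> C) -> (nat -> C)) : square_summable c ->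
  all (fun x => cmod x <= 1) l ->
  (forall w b, L (fun k => w * b k) = (fun k => w * L b k)) ->
  (forall b, square_summable b -> square_summable (L b)) ->
  \sum_(j < size l) cmod (coef_inner c (L (tm_coef l j))) ^+ 2 =
  \sum_(j < size [seq x <- l | cmod x < 1])
    cmod (coef_inner c (L (tm_coef [seq x <- l | cmod x < 1] j))) ^+ 2.
Proof.
move=> hc; elim: l L => //= x l IH L /andP[x1 hl] Lh Ls.
rewrite big_ord_recl/=.
case: ifPn => [x1'|nx].
  rewrite big_ord_recl/=; congr (_ + _).
  apply: (IH (fun b => L (blaschke_mul x (blaschke_mul x b)))) => //.
    by move=> w b; rewrite !blaschke_mulZ Lh.
  by move=> b hb; apply: Ls; do 2 apply: square_summable_output => //.
have xe : cmod x = 1 by apply/eqP; rewrite eq_le x1 leNgt.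
have L0 : L (@nullseq R) = @nullseq R.
  have -> : @nullseq R = (fun k => 0 * @nullseq R k) by apply/funext => k;
    rewrite mul0r.
  by rewrite Lh; apply/funext => k; rewrite !mul0r.
have ip0 : coef_inner c (@nullseq R) = 0.
  have -> : @nullseq R = (fun k => 0 * @nullseq R k) by apply/funext => k;
    rewrite mul0r.
  by rewrite coef_innerZr// ?conj0 ?mul0r//; exact: square_summable_null.
rewrite szego_coef_circle// L0 ip0 cmod0 expr0n/= add0r -IH//.
apply: eq_bigr => j _; congr (_ ^+ 2).
rewrite !blaschke_mul_circle// !Lh.
have hb := Ls _ (@square_summable_tm R l j hl).
rewrite (_ : (fun k => _) = (fun k => (x * x) * L (tm_coef l j) k)); last first.
  by apply/funext => k; ring.
by rewrite coef_innerZr// cmodM cmod_conj cmodM xe !mul1r.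
Qed.

Lemma tm_coef_cat l1 l2 k : (k < size l1)%N -> tm_coef (l1 ++ l2) k = tm_coef l1 k.
Proof. by elim: l1 k => // x l1 IH [|k] //= kl; rewrite IH. Qed.

(** The functions of a system depend only on the parameters up to their
    own, so appending parameters adds nonnegative terms. *)
Lemma captured_energy_cat c l1 l2 : captured_energy c l1 <=
  captured_energy c (l1 ++ l2).
Proof.
rewrite /captured_energy size_cat big_split_ord/=.
rewrite (eq_bigr (fun j : 'I_(size l1) =>
  cmod (coef_inner c (tm_coef (l1 ++ l2) j)) ^+ 2)).
  by rewrite lerDl sumr_ge0// => j _; exact: sqr_ge0.
by move=> j _; rewrite tm_coef_cat.
Qed.

(** Deletes the parameters on the circle and appends as many zeros. *)
Lemma captured_energy_interior c l : square_summable c ->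
  all (fun x => cmod x <= 1) l ->
  exists l', [/\ size l' = size l, all (fun x => cmod x < 1) l' &
    captured_energy c l <= captured_energy c l'].
Proof.
move=> hc hl; pose l1 := [seq x <- l | cmod x < 1].
exists (l1 ++ nseq (size l - size l1) 0); split.
- by rewrite size_cat size_nseq subnKC// size_filter count_size.
- rewrite all_cat filter_all/= all_nseq; apply/orP; right.
  by rewrite cmod0 ltr01.
- apply: le_trans (captured_energy_cat _ _ _).
  by rewrite /captured_energy (@captured_energy_filter c l id).
Qed.

End system.

(** * Maximising the captured energy over the closed polydisc *)

Section continuity.
Variable R : realType.
Set Implicit Arguments. Unset Strict Implicit.
Local Notation C := R[i].
Implicit Types (b c d : nat -> C) (x z w s : C) (l : seq C).

Section param.
Context {T : Type} (F : set_system T) {FF : Filter F}.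
Local Notation "u ~~> l" :=
  ((fun t => u t : R[i]^o) @ F --> (l : R[i]^o)) (at level 70).

Lemma cvg_cmod_sqr (u : T -> C) (l : C) : u ~~> l ->
  cmod (u t) ^+ 2 @[t --> F] --> cmod l ^+ 2.
Proof.
move=> /cvgCP[h1 h2]; rewrite cmod_sqr !expr2.
rewrite (_ : (fun t => _) = (fun t => complex.Re (u t) * complex.Re (u t) +
  complex.Im (u t) * complex.Im (u t))).
  by apply: cvgD; apply: cvgM.
by apply/funext => t; rewrite cmod_sqr !expr2.
Qed.

Lemma cvg_defect (u : T -> C) (l : C) : u ~~> l -> (fun t => defect (u t)) ~~> defect l.
Proof.
move=> h; apply/cvgCP; split; last exact: cvg_cst.
have h2 : 1 - cmod (u t) ^+ 2 @[t --> F] --> 1 - cmod l ^+ 2.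
  by apply: cvgB; [exact: cvg_cst|exact: cvg_cmod_sqr].
exact: (cvg_comp _ _ h2 (@sqrt_continuous _ _)).
Qed.

Lemma cvg_col_state (u : T -> C) (l s : C) (b : T -> nat -> C) (b0 : nat -> C) k :
  u ~~> l -> (forall k, b^~ k ~~> b0 k) ->
  (fun t => col_state (u t) s (b t) k) ~~> col_state l s b0 k.
Proof.
move=> hu hb; elim: k => [|k IH]; first exact: (@cvgC_cst _ _ _ _ s).
apply: cvgC_D; apply: cvgC_M.
- exact: cvgC_conj.
- exact: IH.
- exact: cvg_defect.
- exact: hb.
Qed.

Lemma cvg_col_output (u : T -> C) (l s : C) (b : T -> nat -> C) (b0 : nat -> C) k :
  u ~~> l -> (forall k, b^~ k ~~> b0 k) ->
  (fun t => col_output (u t) s (b t) k) ~~> col_output l s b0 k.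
Proof.
move=> hu hb; apply: cvgC_ext => [|t|].
- apply: cvgC_D; first by apply: cvgC_M;
  [exact: cvg_defect hu|exact: cvg_col_state hu hb].
  apply: cvgC_M; first exact: (@cvgC_cst _ _ _ _ (-1)).
  by apply: cvgC_M; [exact: hu|exact: (hb k)].
- by rewrite /= mulN1r.
- by rewrite mulN1r.
Qed.

(** Each coefficient is obtained from the parameters by finitely many sums,
    products, conjugations and square roots. *)
Lemma cvg_tm_coef (J : Type) (u : T -> J -> C) (u0 : J -> C) (I : seq J) k i :
  (forall j, u^~ j ~~> u0 j) ->
  (fun t => tm_coef (map (u t) I) k i) ~~> tm_coef (map u0 I) k i.
Proof.
move=> hu; elim: I k i => [|j I IH] k i; first exact: (@cvgC_cst _ _ _ _ 0).
case: k => [|k] /=.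
  by apply: cvg_col_output => // m; exact: (@cvgC_cst _ _ _ _ 0).
by apply: cvg_col_output => // m; apply: cvg_col_output => // m'; exact: IH.
Qed.

Lemma cvg_csum (I : Type) (r : seq I) (g : I -> T -> C) (g0 : I -> C) :
  (forall i, g i ~~> g0 i) -> (fun t => \sum_(i <- r) g i t) ~~> \sum_(i <- r) g0 i.
Proof.
move=> hg; elim: r => [|i r IH].
  apply: cvgC_ext => [|t|]; first exact: (@cvgC_cst _ _ _ _ 0).
    by rewrite big_nil.
  by rewrite big_nil.
apply: cvgC_ext => [|t|]; first by apply: cvgC_D; [exact: (hg i)|exact: IH].
  by rewrite big_cons.
by rewrite big_cons.
Qed.

Lemma cvg_rsum (I : Type) (r : seq I) (g : I -> T -> R) (g0 : I -> R) :
  (forall i, g i t @[t --> F] --> g0 i) ->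
  \sum_(i <- r) g i t @[t --> F] --> \sum_(i <- r) g0 i.
Proof.
move=> hg; elim: r => [|i r IH].
  by rewrite big_nil; under eq_fun do rewrite big_nil; exact: cvg_cst.
by rewrite big_cons; under eq_fun do rewrite big_cons; exact: cvgD.
Qed.

End param.

(** |c_k b_k| <= (|c_k|^2 / e + e |b_k|^2) / 2, summed over the tail where c
    has energy at most e^2. *)
Lemma coef_inner_truncate c e : square_summable c -> 0 < e -> exists N, forall b,
  (forall M, \sum_(0 <= k < M) cmod (b k) ^+ 2 <= 1) ->
  cmod (coef_inner c b - \sum_(0 <= k < N) c k * ((b k)^*)%R) <= e.
Proof.
move=> hc e0; have e2 : 0 < e ^+ 2 by rewrite exprn_gt0.
have [N _ HN] : \forall n \near \oo,
  coef_energy c - \sum_(0 <= k < n) cmod (c k) ^+ 2 <= e ^+ 2.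
  have hc' : series (fun k => cmod (c k) ^+ 2) @ \oo --> coef_energy c by exact: hc.
  have /cvgrPdist_le/(_ _ e2) := hc'; apply: filterS => n.
  by apply: le_trans; exact: ler_norm.
exists N => b hb.
have sb : square_summable b by exact: square_summable_bounded hb.
have /cvgC_cmod hip := coef_innerP hc sb.
apply/ler_addgt0Pr => r r0; have [N1 _ HN1] := hip r r0.
pose n := maxn N N1; have Nn : (N <= n)%N by exact: leq_maxl.
have := HN1 n (leq_maxr _ _) => /= h1.
have h2 : cmod (\sum_(N <= k < n) c k * ((b k)^*)%R) <= e.
  apply: (@le_trans _ _ (\sum_(N <= k < n) (e^-1 * cmod (c k) ^+ 2 +
    e * cmod (b k) ^+ 2) / 2)).
    elim/big_ind2: _ => [|p1 p2 q1 q2 k1 k2|k _]; first by rewrite cmod0.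
      by apply: le_trans (cmodD _ _) _; exact: lerD.
    rewrite cmodM cmod_conj ler_pdivlMr//.
    have := cmod_ge0 (c k); have := cmod_ge0 (b k); move: (cmod (c k)) (cmod (b k)) =>
      p q q0 p0.
    have -> : e^-1 * p ^+ 2 + e * q ^+ 2 = e^-1 * (p - e * q) ^+ 2 + p * q * 2.
      by field; rewrite gt_eqF.
    by rewrite lerDr mulr_ge0 ?sqr_ge0// invr_ge0 ltW.
  rewrite -big_distrl/= big_split/= -!big_distrr/=.
  have b1 : \sum_(N <= k < n) cmod (b k) ^+ 2 <= 1.
    apply: le_trans (hb n); rewrite (@big_cat_nat _ _ _ N 0 n)//= lerDr.
    by apply: sumr_ge0 => k _; exact: sqr_ge0.
  have c1 : \sum_(N <= k < n) cmod (c k) ^+ 2 <= e ^+ 2.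
    have := HN N (leqnn N) => /=; apply: le_trans.
    rewrite lerBrDr addrC -big_cat_nat//; exact: partial_energy_le.
  rewrite ler_pdivrMr// mulr2n mulrDr mulr1; apply: lerD.
    by rewrite ler_pdivrMl// -expr2.
  by rewrite -[leRHS]mulr1 ler_pM2l.
have -> : coef_inner c b - \sum_(0 <= k < N) c k * ((b k)^*)%R =
  (coef_inner c b - \sum_(0 <= k < n) c k * ((b k)^*)%R) +
    \sum_(N <= k < n) c k * ((b k)^*)%R.
  by rewrite (@big_cat_nat _ _ _ N 0 n)//=; ring.
apply: le_trans (cmodD _ _) _; rewrite addrC; apply: lerD => //; exact: ltW.
Qed.

Lemma all_mapT (J S : Type) (u : J -> S) (P : pred S) (I : seq J) :
  (forall j, P (u j)) -> all P (map u I).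
Proof. by move=> h; elim: I => //= j I ->; rewrite h. Qed.

(** By [coef_inner_truncate] the inner products are uniformly close to
    finite sums of coefficients, which converge by [cvg_tm_coef]. *)
Lemma captured_energy_cvg (T : Type) (F : set_system T) (FF : Filter F) (J : Type)
    (u : T -> J -> C) (u0 : J -> C) (I : seq J) c : square_summable c ->
  (forall j, (fun t => u t j : R[i]^o) @ F --> (u0 j : R[i]^o)) ->
  (\forall t \near F, forall j, cmod (u t j) <= 1) -> (forall j, cmod (u0 j) <= 1) ->
  captured_energy c (map (u t) I) @[t --> F] --> captured_energy c (map u0 I).
Proof.
move=> hc hu u1 u01.
have hip j : (fun t => coef_inner c (tm_coef (map (u t) I) j) : R[i]^o) @ F -->
    (coef_inner c (tm_coef (map u0 I) j) : R[i]^o).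
  apply/cvgC_cmod => e e0; have e3 : 0 < e / 3 by rewrite divr_gt0.
  have [N HN] := coef_inner_truncate hc e3.
  pose S (v : J -> C) : C := \sum_(0 <= k < N) c k * ((tm_coef (map v I) j k)^*)%R.
  have hS : (fun t => S (u t) : R[i]^o) @ F --> (S u0 : R[i]^o).
    apply: cvg_csum => k; apply: cvgC_M; first exact: (@cvgC_cst _ _ _ _ (c k)).
    by apply: cvgC_conj; exact: cvg_tm_coef.
  have /cvgC_cmod/(_ _ e3) := hS; move: u1; apply: filterS2 => t u1 hS1.
  have b0 : forall M, \sum_(0 <= k < M) cmod (tm_coef (map u0 I) j k) ^+ 2 <= 1.
    by move=> M; apply: tm_coef_energy_le; exact: all_mapT.
  have bt : forall M, \sum_(0 <= k < M) cmod (tm_coef (map (u t) I) j k) ^+ 2 <= 1.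
    by move=> M; apply: tm_coef_energy_le; exact: all_mapT.
  have -> : coef_inner c (tm_coef (map u0 I) j) -
    coef_inner c (tm_coef (map (u t) I) j) =
    (coef_inner c (tm_coef (map u0 I) j) - S u0) +
      ((S u0 - S (u t)) - (coef_inner c (tm_coef (map (u t) I) j) - S (u t))).
    by ring.
  apply: le_lt_trans (cmodD _ _) _; have := HN _ b0; rewrite -/(S u0) => k1.
  have := HN _ bt; rewrite -/(S (u t)) => k2.
  have := cmodD (S u0 - S (u t)) (- (coef_inner c (tm_coef (map (u t) I) j) - S (u t))).
  rewrite cmodN; move: hS1 k1 k2; lra.
rewrite /captured_energy size_map.
rewrite (_ : (fun t => _) =
  (fun t => \sum_(j < size I) cmod (coef_inner c (tm_coef (map (u t) I) j)) ^+ 2));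
  last first.
  by apply/funext => t; rewrite size_map.
apply: cvg_rsum => j; exact: cvg_cmod_sqr.
Qed.

(** The i-th parameter has the coordinates i and n + i of a row vector, so that
    the closed polydisc is a closed subset of a compact box. *)
Definition disc_point n (v : 'rV[R]_(n + n)) (i : 'I_n) : C :=
  v ord0 (lshift n i) +i* v ord0 (rshift n i).

Definition closed_polydisc n : set 'rV[R]_(n + n) :=
  [set v | forall i : 'I_n, cmod (disc_point v i) <= 1].

Lemma disc_point_cvg n (v : 'rV[R]_(n + n)) i :
  (fun w : 'rV[R]_(n + n) => disc_point w i : R[i]^o) @ v --> (disc_point v i : R[i]^o).
Proof.
apply/(@cvgCP R _ _ (nbhs_filter v)); split.
  exact: (@coord_continuous R _ _ ord0 (lshift n i) v).
exact: (@coord_continuous R _ _ ord0 (rshift n i) v).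
Qed.

Lemma compact_polydisc n : compact (@closed_polydisc n).
Proof.
apply: (@subclosed_compact _ _
  [set v : 'rV[R]_(n + n) | forall i, `[-1, 1]%classic (v ord0 i)]).
- have -> : @closed_polydisc n = \bigcap_(i in [set: 'I_n])
     ((fun v => cmod (disc_point v i) ^+ 2) @^-1` [set x | x <= 1]).
    apply/seteqP; split=> v /= h i; have /= := h i.
      by move=> hi _; rewrite expr_le1// cmod_ge0.
    by move=> /(_ I); rewrite /= expr_le1// cmod_ge0.
  apply: closed_bigI => i _; apply: (preimage_closed _ (@closed_le _ 1)) => v _.
  exact: (@cvg_cmod_sqr _ _ (nbhs_filter v) _ _ (@disc_point_cvg n v i)).
- have := @rV_compact R (n + n) (fun=> `[-1, 1]%classic); apply => i.
  exact: segment_compact.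
- move=> v /= h i; rewrite in_itv/= -ler_norml.
  case: (splitP i) => j ij.
    have -> : i = lshift n j by apply/val_inj.
    exact: le_trans (Re_le_cmod (disc_point v j)) (h j).
  have -> : i = rshift n j by apply/val_inj.
  exact: le_trans (Im_le_cmod (disc_point v j)) (h j).
Qed.

Definition captured_at c n (v : 'rV[R]_(n + n)) : R :=
  captured_energy c (map (disc_point v) (enum 'I_n)).

Lemma captured_energy_continuous c n : square_summable c ->
  {within @closed_polydisc n, continuous (@captured_at c n)}.
Proof.
move=> hc; apply/subspace_continuousP => v hv.
apply: (@captured_energy_cvg _ _ (within_filter _ (nbhs_filter v)) _ (@disc_point n)
  (disc_point v)) => //.
  move=> i; apply: cvg_trans (@disc_point_cvg n v i); apply: cvg_app.
  exact: cvg_within.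
exact: withinT.
Qed.

Lemma captured_energy_max c n : square_summable c -> exists2 v, @closed_polydisc n v &
  forall u, @closed_polydisc n u -> captured_at c u <= captured_at c v.
Proof.
move=> hc.
have ne : @closed_polydisc n !=set0.
  by exists 0 => i; rewrite /disc_point !mxE cmod0.
have [v vK hv] := compact_EVT_max ne (@compact_polydisc n)
  (captured_energy_continuous hc).
exists v; first by move: vK; rewrite inE.
by move=> u uK; apply: hv; rewrite inE.
Qed.

Definition coords_of_tuple n (a : 'I_n -> C) : 'rV[R]_(n + n) :=
  row_mx (\row_i complex.Re (a i)) (\row_i complex.Im (a i)).

Lemma coords_of_tupleK n (a : 'I_n -> C) : disc_point (coords_of_tuple a) = a.
Proof.
apply/funext => i; rewrite /disc_point /coords_of_tuple row_mxEl row_mxEr !mxE.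
by case: (a i).
Qed.

End continuity.

(** * Existence of a best approximation *)

Theorem theorem4 (R : realType) (n : nat) (n_gt0 : (0 < n)%N)
    (f : R[i] -> R[i]) (fH : hardy f)
    (f_not_form : forall m : nat, (m < n)%N -> ~ double_blaschke_form m f) :
  exists2 a : 'I_n -> R[i], disc_tuple a &
    hardy_norm (double_TM_residual f a) =
    inf [set hardy_norm (double_TM_residual f b) | b in @disc_tuple R n].
Proof.
have [c fc hc] := fH.
have [v vK vmax] := @captured_energy_max R c n hc.
pose l := map (disc_point v) (enum 'I_n).
have sl : size l = n by rewrite size_map size_enum_ord.
have hl : all (fun x => cmod x <= 1) l by exact: all_mapT.
have [l' [sl' hl' le']] := captured_energy_interior hc hl.
pose a (i : 'I_n) := nth 0 l' i.
have aE : [seq a i | i <- enum 'I_n] = l'.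
  apply: (@eq_from_nth _ 0); first by rewrite size_map size_enum_ord sl' sl.
  move=> i; rewrite size_map size_enum_ord => i_n.
  rewrite (nth_map (Ordinal i_n)) ?size_enum_ord//.
  by rewrite /a nth_enum_ord.
have Da : disc_tuple a.
  by move=> i; have /all_nthP := hl'; apply; rewrite sl' sl.
exists a => //.
have best (b : 'I_n -> R[i]) : disc_tuple b ->
    hardy_norm (double_TM_residual f a) <= hardy_norm (double_TM_residual f b).
  move=> Db; rewrite (hardy_norm_residual fc hc Da) (hardy_norm_residual fc hc Db).
  rewrite aE ler_wsqrtr// lerD2l lerN2; apply: le_trans le'.
  have := vmax (coords_of_tuple b); rewrite /captured_at coords_of_tupleK; apply.
  by move=> i; rewrite coords_of_tupleK; exact/ltW/Db.
apply/eqP; rewrite eq_le; apply/andP; split.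
  apply: lb_le_inf; first by exists (hardy_norm (double_TM_residual f a)); exists a.
  by move=> _ [b Db <-]; exact: best.
apply: ge_inf; last by exists a.
by exists (hardy_norm (double_TM_residual f a)) => _ [b Db <-]; exact: best.
Qed.
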